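(* Let $V=V_0\sqcup V_1$ be a finite vertex set with $V_0,V_1$ nonempty, let $p_b=|V_b|/|V|$ and $p=(p_0,p_1)$, and let $\mathrm{val}:V\to\{0,1\}$ be given by $\mathrm{val}(v)=b$ for $v\in V_b$. For every $\sigma^2$ with $$\frac{1-\min\{\frac{p_0}{p_1},\frac{p_1}{p_0},\frac{1}{100}\}}{1+\min\{\frac{p_0}{p_1},\frac{p_1}{p_0},\frac{1}{100}\}} \cdot p_0p_1 \;\leq\; \sigma^2 \;\leq\; \frac{1+\frac{1}{100}}{1-\frac{1}{100}} \cdot p_0p_1,\qquad \sigma^2>0,$$ there exists a $(p,\sigma^2,c)$-discrete normal family $(\mathcal{N}_{\sigma^2}^t)_{t\in\mathbb{N}}$ with $$c_1=2,\qquad c_2=2020,\qquad c_3=2020.$$ Specifically, such a family is given by $$\mathcal{N}_{\sigma^2}^t=\Sigma\mathrm{val}(\mathrm{RW}_{G_{\lambda,p}}^t),$$ where $G_{\lambda,p}$ denotes the $\lambda$-sticky, $p$-biased random walk on $V$ with $\lambda=(\sigma^2-p_0p_1)/(\sigma^2+p_0p_1)$.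
   Context: Sticky walk. For $A,B\subseteq V$ let $J_{A,B}\in\mathbb{R}^{A\times B}$ be the matrix with all entries equal to $1/|A|$. For $-\min\{p_0/p_1,p_1/p_0\}\le\lambda\le1$, the $\lambda$-sticky, $p$-biased random walk matrix $G_{\lambda,p}\in\mathbb{R}^{V\times V}$ is $$G_{\lambda,p}=\begin{pmatrix}(p_0+p_1\lambda)J_{V_0,V_0}&(p_0-p_0\lambda)J_{V_0,V_1}\\(p_1-p_1\lambda)J_{V_1,V_0}&(p_1+p_0\lambda)J_{V_1,V_1}\end{pmatrix}.$$ Random walks. For a random walk matrix $G\in[0,1]^{V\times V}$ (columns summing to $1$; $G_{v',v}$ is the transition probability from $v$ to $v'$), $\mathrm{RW}_G^t$ is the distribution on $V^t$ of $(v_0,\dots,v_{t-1})$ where $v_0$ is uniform in $V$ and $\Pr[v_i=v\mid v_{i-1}]=G_{v,v_{i-1}}$ for $1\le i\le t-1$. $\Sigma\mathrm{val}(\mathrm{RW}_G^t)$ denotes (the distribution of) $\sum_{i=0}^{t-1}\mathrm{val}(v_i)$ for $(v_0,\dots,v_{t-1})\sim\mathrm{RW}_G^t$. $d_{\mathrm{TV}}$ is total variation distance: for distributions on $\mathbb{Z}$, $d_{\mathrm{TV}}(X,Y)=\frac12\sum_{j\in\mathbb{Z}}|\Pr[X=j]-\Pr[Y=j]|$. $\mathbb{N}$ denotes the positive integers, and $\mathbb{R}_+$ the positive reals. Discrete normal family. For $p=(p_0,p_1)$ with $p_0+p_1=1$, $\sigma^2>0$ and $c=(c_1,c_2,c_3)\in\mathbb{R}_+^3$,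 a $(p,\sigma^2,c)$-discrete normal family is a family $(\mathcal{N}_{\sigma^2}^t)_{t\in\mathbb{N}}$ of probability distributions over $\mathbb{Z}$ such that for all $t\in\mathbb{N}$ (identifying a distribution with a random variable having it): 1. $\mathbb{E}[\mathcal{N}_{\sigma^2}^t]=p_1t$. 2. $|\operatorname{Var}(\mathcal{N}_{\sigma^2}^t)-\sigma^2t|\le c_1\cdot|\sigma^2-p_0p_1|$. 3. $\mathcal{N}_{\sigma^2}^1=\mathrm{Bern}(p)$, the Bernoulli distribution taking value $b$ with probability $p_b$. 4. For all positive integers $\ell\le t$ and $t_0,\dots,t_{\ell-1}$ with $\sum_{i=0}^{\ell-1}t_i=t$, $$d_{\mathrm{TV}}\Bigl(\sum_{i=0}^{\ell-1}\mathcal{N}_{\sigma^2}^{t_i},\;\mathcal{N}_{\sigma^2}^t\Bigr)\le\frac{c_2}{2}\cdot\frac{(\ell-1)\cdot|\sigma^2/(p_0p_1)-1|}{t},$$ where the variables in the sum are independent. 5. For all $a\ge0$, $$\sum_{j\in\mathbb{Z}:|j-p_1t|\ge a}\bigl|\Pr[\mathcal{N}_{\sigma^2}^t=j]-\Pr[\mathrm{Bin}(t,p)=j]\bigr|\le c_3\cdot|\sigma^2/(p_0p_1)-1|\cdot e^{-a^2/(8t)},$$ where $\mathrm{Bin}(t,p)$ is the binomial distribution with $t$ trials and success probability $p_1$. 6. $|\mathbb{E}[e^{-i\theta\mathcal{N}_{\sigma^2}^t}]|\le e^{-p_0p_1t\theta^2/20}$ for all $\theta\in[-\pi,\pi]$.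 *)

(* Defs.v *)
From HB Require Import structures.
From mathcomp Require Import all_boot all_order all_algebra.
From mathcomp Require Import all_classical all_reals all_analysis.
From mathcomp Require Import complex.

Set Implicit Arguments.
Unset Strict Implicit.
Unset Printing Implicit Defensive.

Import Order.TTheory GRing.Theory Num.Theory.
Import numFieldNormedType.Exports.

Local Open Scope classical_set_scope.
Local Open Scope ring_scope.

(* As for [nat] in the library, [int] carries the sigma-algebra of all its
   subsets; probability distributions over the integers are the elements of
   [probability int R]. *)
HB.instance Definition _ := isPointed.Build int 0.
HB.instance Definition _ := @isMeasurable.Build default_measure_display
  int discrete_measurable discrete_measurable0
  discrete_measurableC discrete_measurableU.

Section Convolution.

Definition addz_pair (x : int * int) : int := x.1 + x.2.

Lemma measurable_addz_pair : measurable_fun [set: int * int] addz_pair.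
Proof.
move=> _ A _; rewrite setTI.
have -> : addz_pair @^-1` A =
    \bigcup_(j : int) ([set j] `*` [set k | A (j + k)]).
  by apply/seteqP; split=> -[j k] /=; [exists j | case=> i _ [/= -> ]].
by apply: countable_bigcupT_measurable => // j; apply: measurableX.
Qed.

HB.instance Definition _ :=
  isMeasurableFun.Build _ _ _ _ addz_pair measurable_addz_pair.

Context {R : realType}.

(* Law of X + Y for independent X ~ P and Y ~ Q. *)
Definition convolution (P Q : probability int R) : probability int R :=
  distribution (P \x Q)%E addz_pair.

(* Law of the sum of independent variables with laws P 0, ..., P (l - 1). *)
Definition indep_sum (l : nat) (P : 'I_l -> probability int R) :
    probability int R :=
  \big[convolution/(\d_(0 : int) : probability int R)]_(i < l) P i.

End Convolution.

Section DiscreteNormalFamily.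
Context {R : realType}.

Definition dTV (P Q : set int -> \bar R) : \bar R :=
  ((2^-1)%:E * \esum_(j in [set: int]) `|P [set j] - Q [set j]|)%E.

Definition bernoulliZ (p1 : R) : set int -> \bar R :=
  pushforward (bernoulli_prob p1) (fun b : bool => (nat_of_bool b)%:Z).

Definition binomialZ (t : nat) (p1 : R) : set int -> \bar R :=
  pushforward (binomial_prob t p1) Posz.

(* E[exp(- i theta X)] for X ~ P, as E[cos(- theta X)] + i E[sin(- theta X)];
   both integrands are bounded, so [fine] loses nothing. *)
Definition char_fun (P : probability int R) (theta : R) : R[i] :=
  Complex (fine ('E_P[fun j : int => cos (- theta * j%:~R)])%E)
          (fine ('E_P[fun j : int => sin (- theta * j%:~R)])%E).

Local Notation idZ := (fun j : int => j%:~R : R).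

(* The index set is that of the positive integers: [N 0] is irrelevant. *)
Record discrete_normal_family (p0 p1 sigma2 c1 c2 c3 : R)
    (N : nat -> probability int R) : Prop := DiscreteNormalFamily {
  dnf_param : [/\ p0 + p1 = 1, 0 < sigma2, 0 < c1, 0 < c2 & 0 < c3] ;
  dnf_mean : forall t : nat, (0 < t)%N ->
    ('E_(N t)[idZ] = (p1 * t%:R)%:E)%E ;
  dnf_variance : forall t : nat, (0 < t)%N ->
    (`| 'V_(N t)[idZ] - (sigma2 * t%:R)%:E |
       <= (c1 * `|sigma2 - p0 * p1|%R)%:E)%E ;
  dnf_bernoulli : forall A : set int, N 1%N A = bernoulliZ p1 A ;
  dnf_sum : forall (t l : nat) (ts : 'I_l -> nat),
    (0 < t)%N -> (0 < l <= t)%N -> (forall i, (0 < ts i)%N) ->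
    (\sum_(i < l) ts i = t)%N ->
    (dTV (indep_sum (fun i => N (ts i))) (N t)
       <= (c2 / 2 * ((l%:R - 1) * `|sigma2 / (p0 * p1) - 1|%R / t%:R))%:E)%E ;
  dnf_tail : forall (t : nat) (a : R), (0 < t)%N -> 0 <= a ->
    (\esum_(j in [set j : int | (a <= `|j%:~R - p1 * t%:R|)%R])
        `| N t [set j] - binomialZ t p1 [set j] |
       <= (c3 * `|sigma2 / (p0 * p1) - 1|%R
             * expR (- a ^+ 2 / (8 * t%:R)))%:E)%E ;
  dnf_char : forall (t : nat) (theta : R), (0 < t)%N -> - pi <= theta <= pi ->
    `|char_fun (N t) theta|
       <= (expR (- (p0 * p1 * t%:R * theta ^+ 2) / 20))%:C%C
}.

End DiscreteNormalFamily.

(* A matrix indexed by V x V is a function [G : V -> V -> R]; [G v' v] is the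
   entry in row v' and column v, the transition probability from v to v'. *)
Section RandomWalks.
Context {R : realType} {V : finType}.

Definition random_walk_matrix (G : V -> V -> R) : Prop :=
  (forall v' v, 0 <= G v' v <= 1) /\ (forall v, \sum_v' G v' v = 1).

Definition rw_pmf (G : V -> V -> R) (t : nat) (w : t.-tuple V) : R :=
  if tval w is v0 :: s then
    #|V|%:R^-1 * \prod_(g <- pairmap (fun v v' => G v' v) v0 s) g
  else 1.

Definition sum_val_rw (val : V -> int) (G : V -> V -> R) (t : nat) :
    set int -> \bar R :=
  fun A => (\sum_(w : t.-tuple V | \sum_(v <- w) val v \in A) rw_pmf G w)%:E.

(* Entry of the averaging block J_{A,B}; it depends on A only. *)
Definition J_entry (A : {set V}) : R := #|A|%:R^-1.

Definition sticky_walk (V0 V1 : {set V}) (p0 p1 lambda : R) (v' v : V) : R :=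
  if v' \in V0 then
    if v \in V0 then (p0 + p1 * lambda) * J_entry V0
    else (p0 - p0 * lambda) * J_entry V0
  else
    if v \in V0 then (p1 - p1 * lambda) * J_entry V1
    else (p1 + p0 * lambda) * J_entry V1.

End RandomWalks.

(* Main.v *)
Require Import Defs.
From HB Require Import structures.
From mathcomp Require Import all_boot all_order all_algebra.
From mathcomp Require Import all_classical all_reals all_analysis.
From mathcomp Require Import complex.
From mathcomp Require Import ring lra zify.
Set Implicit Arguments.
Unset Strict Implicit.
Unset Printing Implicit Defensive.
Import Order.TTheory GRing.Theory Num.Theory.
Import numFieldNormedType.Exports.
Local Open Scope ring_scope.

(* Projected on {0, 1}, the walk is a chain that copies its state with weight
   lambda and resamples it from p otherwise.  Laws are handled as generating
   polynomials, measured by the norms sum_i |f_i| y^i.  Changing the weight of a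
   single step from lambda to 0 changes the generating function of the sum by
   lambda p0 p1 (1 - X)^2 u u', where u and u' come from the two halves of the
   walk.  With probability bounded below, whatever the initial state, three
   consecutive steps contain an independent Bernoulli variable, so that u inherits
   the smoothness of a binomial law: (1 - X)^2 u has norm O(1 / (p0 p1 t)).  Hence
   each such change costs O(|lambda| / t).  Cutting the walk into l independent
   pieces takes l - 1 changes, and turning it into a binomial takes t - 1 of them;
   for the tails the latter comparison is made in the norm with y = e^s, where
   s = a / (6 t) and s = - a / (6 t).
   The characteristic function decays because a weighted l^2 energy
   |s|^2 + |lambda| tau |u|^2 contracts at every step of the chain. *)

(** * Weighted l^1 norms of polynomials, and Cauchy-Schwarz *)

Section WeightedNorm.
Context {R : realFieldType}.
Implicit Types (y c : R) (f g : {poly R}).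

(** Two obstacles shape the estimates. First, [lambda] may be negative, so mixing a copy with a
    resampling is only an algebraic identity: no coupling is available, and positivity has to come
    from the transition probabilities themselves. Second, p0 p1 may be arbitrarily small while all
    constants are absolute. Switching a step yields an explicit factor p0 p1 and smoothing loses 1 /
    (p0 p1); the two cancel only if the fresh Bernoulli variable appears with a probability that
    does not depend on p. Hence the detour through the majority state, whose weight is at least 1/2.
    Each bound is relative to the value of [sum_gf] at y, which dominates the norm of [gap_gf] up to
    a factor 5/4 because |lambda| <= 1/100. Both factors 1 - X are charged to the longer half of the
    walk, so that nothing is asked of a short half. The range 5/6 <= y <= 6/5 suffices for the
    tails: only a <= t matters there, so the exponent a / (6 t) is at most 1/6. *)

Definition wnorm y f : R := \sum_(i < size f) `|f`_i| * y ^+ i.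

Lemma wnorm_wide y f n : (size f <= n)%N -> wnorm y f = \sum_(i < n) `|f`_i| * y ^+ i.
Proof.
move=> le_fn; rewrite /wnorm (big_ord_widen n (fun i => `|f`_i| * y ^+ i)) //.
rewrite big_mkcond; apply: eq_bigr => i _; case: ltnP => // le_fi.
by rewrite nth_default // normr0 mul0r.
Qed.

Lemma wnorm_ge0 y f : 0 <= y -> 0 <= wnorm y f.
Proof. by move=> y0; apply: sumr_ge0 => i _; rewrite mulr_ge0 ?exprn_ge0. Qed.

Lemma wnorm0 y : wnorm y 0 = 0.
Proof. by rewrite /wnorm size_poly0 big_ord0. Qed.

Lemma wnormZ y c f : wnorm y (c *: f) = `|c| * wnorm y f.
Proof.
rewrite (wnorm_wide _ (size_scale_leq _ _)) /wnorm mulr_sumr.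
by apply: eq_bigr => i _; rewrite coefZ normrM mulrA.
Qed.

Lemma wnormN y f : wnorm y (- f) = wnorm y f.
Proof. by rewrite -scaleN1r wnormZ normrN1 mul1r. Qed.

Lemma wnormD y f g : 0 <= y -> wnorm y (f + g) <= wnorm y f + wnorm y g.
Proof.
move=> y0; rewrite (wnorm_wide _ (size_polyD _ _)).
rewrite (wnorm_wide _ (leq_maxl (size f) (size g))).
rewrite (wnorm_wide _ (leq_maxr (size f) (size g))) -big_split.
by apply: ler_sum => i _; rewrite /= -mulrDl ler_wpM2r ?exprn_ge0 // coefD ler_normD.
Qed.

Lemma wnorm_sum y I (r : seq I) (F : I -> {poly R}) : 0 <= y ->
  wnorm y (\sum_(i <- r) F i) <= \sum_(i <- r) wnorm y (F i).
Proof.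
move=> y0; elim/big_rec2: _ => [|i a f _ le_fa]; first by rewrite wnorm0.
by rewrite (le_trans (wnormD _ _ y0)) // lerD2l.
Qed.

Lemma wnormMXn y f n : wnorm y ('X^n * f) = y ^+ n * wnorm y f.
Proof.
have le_s : (size ('X^n * f)%R <= n + size f)%N.
  by rewrite (leq_trans (size_polyMleq _ _)) // size_polyXn.
rewrite (wnorm_wide _ le_s) big_split_ord /= big1 ?add0r => [|i _].
  rewrite mulr_sumr; apply: eq_bigr => i _.
  by rewrite coefXnM ltnNge leq_addr /= addKn exprD mulrCA.
by rewrite coefXnM ltn_ord normr0 mul0r.
Qed.

Lemma wnormM y f g : 0 <= y -> wnorm y (f * g) <= wnorm y f * wnorm y g.
Proof.
move=> y0; rewrite -{1}[f]coefK poly_def mulr_suml.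
apply: (le_trans (wnorm_sum _ _ y0)); rewrite [leRHS]mulr_suml.
by apply: ler_sum => i _; rewrite -scalerAl wnormZ wnormMXn mulrA.
Qed.

Definition nnegp f := forall i, 0 <= f`_i.

Lemma wnorm_nneg y f : nnegp f -> wnorm y f = f.[y].
Proof.
by move=> f0; rewrite horner_coef; apply: eq_bigr => i _; rewrite ger0_norm.
Qed.

Lemma horner_le_wnorm y f : 0 <= y -> `|f.[y]| <= wnorm y f.
Proof.
move=> y0; rewrite horner_coef (le_trans (ler_norm_sum _ _ _)) //.
by apply: ler_sum => i _; rewrite normrM [`|y ^+ i|]ger0_norm ?exprn_ge0.
Qed.

Lemma nnegpD f g : nnegp f -> nnegp g -> nnegp (f + g).
Proof. by move=> f0 g0 i; rewrite coefD addr_ge0. Qed.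

Lemma nnegpZ c f : 0 <= c -> nnegp f -> nnegp (c *: f).
Proof. by move=> c0 f0 i; rewrite coefZ mulr_ge0. Qed.

Lemma nnegpM f g : nnegp f -> nnegp g -> nnegp (f * g).
Proof. by move=> f0 g0 i; rewrite coefM sumr_ge0 // => j _; rewrite mulr_ge0. Qed.

Lemma nnegpXn n : nnegp ('X^n : {poly R}).
Proof. by move=> i; rewrite coefXn ler0n. Qed.

Lemma nnegp_sum I (r : seq I) (F : I -> {poly R}) :
  (forall i, nnegp (F i)) -> nnegp (\sum_(i <- r) F i).
Proof.
by move=> F0; elim/big_ind: _ => // [i|]; [rewrite coef0 | exact: nnegpD].
Qed.

Lemma nnegpX f n : nnegp f -> nnegp (f ^+ n).
Proof.
move=> f0; elim: n => [|n IHn]; first by rewrite expr0 => i; rewrite coef1 ler0n.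
by rewrite exprS; apply: nnegpM.
Qed.

(** Cauchy-Schwarz, read off the nonnegative variance of [|m i|] under the unnormalised weights [w].
    Total weight 0 is set apart because the identity is divided by it. *)
Lemma weighted_sqr_sum_le n (w m : 'I_n -> R) : (forall i, 0 <= w i) ->
  (\sum_i w i * `|m i|) ^+ 2 <= (\sum_i w i) * \sum_i w i * m i ^+ 2.
Proof.
move=> w0; set M := \sum_i w i * `|m i|; set W := \sum_i w i; set Q := \sum_i _ * _ ^+ 2.
have [W0|W0] := eqVneq W 0.
  have wz i : w i = 0.
    apply/eqP; move: W0 => /eqP; rewrite psumr_eq0 => [/allP/(_ i)|//].
    by rewrite mem_index_enum => /(_ isT).
  by rewrite W0 mul0r /M big1 ?expr0n // => i _; rewrite wz mul0r.
have Wp : 0 < W by rewrite lt_neqAle eq_sym W0 sumr_ge0.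
have : 0 <= \sum_i w i * (`|m i| * W - M) ^+ 2.
  by apply: sumr_ge0 => i _; rewrite mulr_ge0 // sqr_ge0.
have -> : \sum_i w i * (`|m i| * W - M) ^+ 2 = W * (W * Q - M ^+ 2).
  have eqi i : w i * (`|m i| * W - M) ^+ 2 =
      W ^+ 2 * (w i * m i ^+ 2) - 2 * W * M * (w i * `|m i|) + M ^+ 2 * w i.
    by rewrite -[m i ^+ 2]real_normK ?num_real //; ring.
  rewrite (eq_bigr _ (fun i _ => eqi i)) big_split sumrB -!mulr_sumr /=.
  by rewrite -/M -/W -/Q; ring.
by rewrite pmulr_rge0 // subr_ge0.
Qed.

End WeightedNorm.

(** * Smoothness of binomial laws *)

Section BernoulliSmoothing.
Context {R : realFieldType} (p0 p1 : R).
Context (p0_gt0 : 0 < p0) (p1_gt0 : 0 < p1) (p01 : p0 + p1 = 1).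

Definition bern : {poly R} := p0%:P + p1 *: 'X.

Lemma horner_bern y : bern.[y] = p0 + p1 * y.
Proof. by rewrite /bern !hornerE. Qed.

Lemma bern_gt0 y : 0 < y -> 0 < bern.[y].
Proof. by move=> y0; rewrite horner_bern addr_gt0 ?mulr_gt0. Qed.

Lemma nnegp_bern : nnegp bern.
Proof.
move=> i; rewrite coefD coefC coefZ coefX; case: ifP => _; apply: addr_ge0;
  by rewrite ?mulr_ge0 ?ler0n ?(ltW p0_gt0) ?(ltW p1_gt0).
Qed.

(* The score of the binomial law: [(n p1 - k) h_k] is the coefficient of the
   operator [h |-> n p1 h - X h'], which maps [B^n] to [n p0 p1 (1 - X) B^(n-1)]. *)
Definition score n (h : {poly R}) : {poly R} := (n%:R * p1) *: h - 'X * h^`().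

Lemma coef_score n h i : (score n h)`_i = h`_i * (n%:R * p1 - i%:R).
Proof.
rewrite /score coefB coefZ coefXM coef_deriv; case: i => [|i] /=.
  by rewrite !subr0 mulrC.
by rewrite -mulr_natr; ring.
Qed.

Lemma size_score n h : (size (score n h) <= size h)%N.
Proof.
by apply/leq_sizeP => i le_i; rewrite coef_score nth_default // mul0r.
Qed.

Lemma deriv_bern : bern^`() = p1%:P.
Proof. by rewrite /bern derivD derivZ derivC derivX add0r alg_polyC. Qed.

Lemma score_bern m :
  score m.+1 (bern ^+ m.+1) = (m.+1%:R * (p0 * p1)) *: ((1 - 'X) * bern ^+ m).
Proof.
rewrite /score deriv_exp deriv_bern -!mul_polyC -mulr_natr exprS /= !polyCM !polyC_natr.
have -> : p0%:P = 1 - p1%:P :> {poly R} by rewrite -polyCB -p01 addrK.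
rewrite {1}/bern -mul_polyC.
have -> : p0%:P = 1 - p1%:P :> {poly R} by rewrite -polyCB -p01 addrK.
by ring.
Qed.

(** Second moment of the score under the binomial law tilted by y^k. The factor [bern.[y]] on the
    left avoids the power [m - 1] that differentiation produces. *)
Lemma horner_score_bern m y :
  (score m.+1 (score m.+1 (bern ^+ m.+1))).[y] * bern.[y] =
  m.+1%:R * (p0 * p1) * (m.+1%:R * (p0 * p1) * (1 - y) ^+ 2 + y) * bern.[y] ^+ m.
Proof.
rewrite score_bern {1}/score derivZ derivM deriv_exp deriv_bern derivB derivX derivC.
rewrite !(hornerD, hornerN, hornerM, hornerZ, hornerC, hornerX, hornerMn, horner_exp).
have -> : p0 = 1 - p1 by rewrite -p01 addrK.
case: m => [|m] /=; first by rewrite !expr0 mulr0n; ring.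
by rewrite -mulr_natr !exprS -!natr1; ring.
Qed.

(** A Fisher information argument: up to the factor n p0 p1, [(1 - X) B^m] is the score of [B^n]
    with n = m + 1, so its norm is an absolute first moment, which Cauchy-Schwarz bounds by the
    second. Tilting by y shifts the mean, whence the term [(1 - y)^2]. *)
Lemma wnorm_diff_bern m y : 0 < y ->
  wnorm y ((1 - 'X) * bern ^+ m) ^+ 2 <=
    bern.[y] ^+ (m + m) * (y / (m.+1%:R * (p0 * p1)) + (1 - y) ^+ 2).
Proof.
move=> y0; set n := m.+1; set e := p0 * p1; set h := bern ^+ n.
have e0 : 0 < e by rewrite mulr_gt0.
have n0 : 0 < n%:R :> R by rewrite ltr0n.
have b0 := bern_gt0 y0.
have h0 : nnegp h by apply: nnegpX; apply: nnegp_bern.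
have := @weighted_sqr_sum_le R (size h) (fun i => h`_i * y ^+ i)
  (fun i => n%:R * p1 - (i : nat)%:R).
move=> /(_ (fun i => mulr_ge0 (h0 i) (exprn_ge0 _ (ltW y0)))).
have -> : \sum_(i < size h) h`_i * y ^+ i * `|n%:R * p1 - i%:R| = wnorm y (score n h).
  rewrite (wnorm_wide _ (size_score _ _)); apply: eq_bigr => i _.
  by rewrite coef_score normrM (ger0_norm (h0 i)) mulrAC.
rewrite -horner_coef.
have -> : \sum_(i < size h) h`_i * y ^+ i * (n%:R * p1 - i%:R) ^+ 2 =
    (score n (score n h)).[y].
  have le_s : (size (score n (score n h)) <= size h)%N.
    by rewrite (leq_trans (size_score _ _)) ?size_score.
  rewrite (horner_coef_wide _ le_s); apply: eq_bigr => i _.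
  by rewrite !coef_score; ring.
have := horner_score_bern m y; set S := (score n (score n h)).[y] => SE.
rewrite {1}/h score_bern wnormZ ger0_norm; last by rewrite mulr_ge0 ?ltW.
have -> : h.[y] = bern.[y] * bern.[y] ^+ m by rewrite /h horner_exp exprS.
rewrite exprMn [leRHS]mulrAC [_ * S]mulrC {}SE.
set N := wnorm _ _; set b := bern.[y] => leN.
have -> : y / (n%:R * e) + (1 - y) ^+ 2 = (n%:R * e * (1 - y) ^+ 2 + y) / (n%:R * e).
  by field; rewrite (gt_eqF e0) (gt_eqF n0).
have ne0 : 0 < n%:R * e by rewrite mulr_gt0.
rewrite mulrA ler_pdivlMr // -(ler_pM2r ne0) exprD.
have -> : N ^+ 2 * (n%:R * e) * (n%:R * e) = (n%:R * e) ^+ 2 * N ^+ 2 by ring.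
have -> : forall Z, b ^+ m * b ^+ m * Z * (n%:R * e) = n%:R * e * Z * b ^+ m * b ^+ m.
  by move=> Z; ring.
exact: leN.
Qed.

(** Each half of the binomial absorbs one factor [1 - X]. Both exponents are at least (j - 1) / 2,
    which gives the factor 2. *)
Lemma wnorm_diff2_bern j y : 0 < y ->
  wnorm y ((1 - 'X) ^+ 2 * bern ^+ j) <=
    bern.[y] ^+ j * (2 * y / (j.+1%:R * (p0 * p1)) + (1 - y) ^+ 2).
Proof.
move=> y0; set E := _ + (1 - y) ^+ 2.
have b0 := bern_gt0 y0; have e0 : 0 < p0 * p1 by rewrite mulr_gt0.
pose j1 := j./2; pose j2 := (j - j./2)%N.
have jE : j = (j1 + j2)%N by rewrite /j1 /j2; lia.
have half (i : nat) : (j.+1 <= 2 * i.+1)%N ->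
    wnorm y ((1 - 'X) * bern ^+ i) ^+ 2 <= (bern.[y] ^+ i) ^+ 2 * E.
  move=> le_ji; apply: (le_trans (wnorm_diff_bern i y0)).
  rewrite exprD -expr2 ler_wpM2l ?sqr_ge0 // lerD2r.
  rewrite ler_pdivrMr ?mulr_gt0 ?ltr0n // mulrAC ler_pdivlMr ?mulr_gt0 ?ltr0n //.
  have : j.+1%:R <= 2 * i.+1%:R :> R by rewrite -natrM ler_nat.
  by move=> H; have := ler_wpM2l (ltW (mulr_gt0 y0 e0)) H; nra.
have n1 := half j1 _; have n2 := half j2 _.
have E0 : 0 <= E by rewrite addr_ge0 ?sqr_ge0 // divr_ge0 ?mulr_ge0 ?ler0n ?ltW.
have -> : (1 - 'X) ^+ 2 * bern ^+ j = ((1 - 'X) * bern ^+ j1) * ((1 - 'X) * bern ^+ j2).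
  by rewrite {1}jE exprD; ring.
apply: (le_trans (wnormM _ _ (ltW y0))).
rewrite -ler_sqr ?nnegrE ?mulr_ge0 ?wnorm_ge0 ?exprn_ge0 ?(ltW y0) ?(ltW b0) //.
rewrite exprMn; apply: le_trans (ler_pM (sqr_ge0 _) (sqr_ge0 _) (n1 _) (n2 _)) _.
- by rewrite /j1; lia.
- by rewrite /j2; lia.
by rewrite {1}jE exprD le_eqVlt; apply/orP; left; apply/eqP; ring.
Qed.
End BernoulliSmoothing.

(** * The two-state chain: generating functions, smoothing, switching of steps *)

Section StickyChain.
Context {R : realFieldType} (p0 p1 : R).
Context (p0_gt0 : 0 < p0) (p1_gt0 : 0 < p1) (p01 : p0 + p1 = 1).

Local Notation B := (bern p0 p1).
Local Notation eps := (p0 * p1).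

Definition bernc : {poly R} := p1%:P + p0 *: 'X.

(* Projected on {0, 1}, the walk keeps its state with (possibly negative) weight
   [l] and resamples it from (p0, p1) with weight [1 - l]; [ls] lists the weights
   of the successive steps.  [chain ls] is the pair (s, u) where s is the
   generating function of the sum of the [size ls + 1] states and (1 - X) u is
   the difference between those conditioned on starting at 0 and at 1. *)
Definition chain_step (l : R) (su : {poly R} * {poly R}) : {poly R} * {poly R} :=
  (B * su.1 + (l * eps) *: ((1 - 'X) ^+ 2 * su.2), su.1 + l *: (bernc * su.2)).

Definition chain (ls : seq R) : {poly R} * {poly R} := foldr chain_step (B, 1) ls.

Definition sum_gf ls : {poly R} := (chain ls).1.
Definition gap_gf ls : {poly R} := (chain ls).2.

Lemma sum_gf_cons l ls :
  sum_gf (l :: ls) = B * sum_gf ls + (l * eps) *: ((1 - 'X) ^+ 2 * gap_gf ls).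
Proof. by []. Qed.

Lemma gap_gf_cons l ls : gap_gf (l :: ls) = sum_gf ls + l *: (bernc * gap_gf ls).
Proof. by []. Qed.

Definition pr (b : bool) : R := if b then p1 else p0.

Lemma pr_gt0 b : 0 < pr b. Proof. by case: b. Qed.

Lemma pr_lt1 b : pr b < 1.
Proof. by rewrite -p01; case: b; rewrite ?ltrDl ?ltrDr. Qed.

Definition trans (l : R) (a b : bool) : R := l * (a == b)%:R + (1 - l) * pr b.

Lemma trans_sum l a : \sum_b trans l a b = 1.
Proof.
rewrite big_bool /trans /=; have -> : p0 = 1 - p1 by rewrite -p01 addrK.
by case: a => /=; ring.
Qed.

(* The generating function conditioned on the initial state [a]. *)
Fixpoint start_gf (ls : seq R) (a : bool) : {poly R} :=
  if ls is l :: ls' then 'X^a * \sum_b trans l a b *: start_gf ls' b else 'X^a.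

Lemma start_gfE ls a :
  start_gf ls a = sum_gf ls + (if a then - p0 else p1) *: ((1 - 'X) * gap_gf ls).
Proof.
have e0 : p0%:P = 1 - p1%:P :> {poly R} by rewrite -polyCB -p01 addrK.
elim: ls a => [|l ls IHls] a.
  rewrite /sum_gf /gap_gf /= /bern -!mul_polyC; case: a => /=;
  by rewrite ?polyCN e0 ?expr0 ?expr1; ring.
rewrite /= big_bool !IHls sum_gf_cons gap_gf_cons /trans /bern /bernc -!mul_polyC.
case: a => /=; rewrite ?(polyCD, polyCM, polyCN, polyCB, polyC1, polyC0) !e0 ?expr0 ?expr1; by ring.
Qed.

Lemma sum_gfE ls : sum_gf ls = \sum_b pr b *: start_gf ls b.
Proof.
have e0 : p0%:P = 1 - p1%:P :> {poly R} by rewrite -polyCB -p01 addrK.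
by rewrite big_bool !start_gfE /pr /= -!mul_polyC !polyCN !e0; ring.
Qed.

(** Nonnegativity is required of the transitions, not of [l]. Both [lambda] and 0 qualify, so walks
    with some steps switched stay in the class. *)
Definition admissible (l : R) : bool :=
  (`|l| <= 1 / 100) && [forall a, forall b, 0 <= trans l a b].

Lemma admissible_trans l a b : admissible l -> 0 <= trans l a b.
Proof. by case/andP=> _ /forallP/(_ a)/forallP/(_ b). Qed.

Lemma admissible_norm l : admissible l -> - (1 / 100) <= l <= 1 / 100.
Proof. by case/andP; rewrite ler_norml. Qed.

Lemma nnegp_start_gf ls a : all admissible ls -> nnegp (start_gf ls a).
Proof.
elim: ls a => [|l ls IHls] a /=; first by move=> _; apply: nnegpXn.
case/andP=> adml admls; apply: nnegpM; first exact: nnegpXn.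
by apply: nnegp_sum => b; apply: nnegpZ; [apply: admissible_trans | apply: IHls].
Qed.

Lemma nnegp_sum_gf ls : all admissible ls -> nnegp (sum_gf ls).
Proof.
move=> admls; rewrite sum_gfE; apply: nnegp_sum => b.
by apply: nnegpZ; [apply/ltW/pr_gt0 | apply: nnegp_start_gf].
Qed.

Lemma eps_gt0 : 0 < eps. Proof. exact: mulr_gt0. Qed.

Lemma eps_le : eps <= 1 / 4.
Proof.
have e0 : p0 = 1 - p1 by rewrite -p01 addrK.
by rewrite e0; have := sqr_ge0 (p1 - 1 / 2); nra.
Qed.

Section Weighted.
Context (y : R) (y_bnd : 5 / 6 <= y <= 6 / 5).
Let y_gt0 : 0 < y. Proof. by case/andP: y_bnd => + _; apply: lt_le_trans; lra. Qed.
Let y_ge0 : 0 <= y. Proof. exact: ltW. Qed.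

Lemma horner_bern_bnd : 5 / 6 <= B.[y] <= 6 / 5.
Proof.
rewrite horner_bern.
case/andP: y_bnd => /(ler_wpM2l (ltW p1_gt0)) h1 /(ler_wpM2l (ltW p1_gt0)) h2.
by move: p0_gt0 p1_gt0 p01 => *; apply/andP; split; lra.
Qed.

Lemma wnorm_bernc : wnorm y bernc <= 6 / 5.
Proof.
have -> : wnorm y bernc = bernc.[y].
  by apply: wnorm_nneg; apply: nnegp_bern.
rewrite /bernc !hornerE; case/andP: y_bnd => _ /(ler_wpM2l (ltW p0_gt0)).
by move: p0_gt0 p1_gt0 p01; lra.
Qed.

Lemma sqr_1By_le : (1 - y) ^+ 2 <= 1 / 25.
Proof. by case/andP: y_bnd => ? ?; nra. Qed.

Lemma horner_1X2 : ((1 - 'X) ^+ 2).[y] = (1 - y) ^+ 2.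
Proof. by rewrite horner_exp hornerD hornerN hornerX hornerC. Qed.

(** 1/320 is the product of the bounds 1/100 on |l|, 1/4 on p0 p1 and 5/4 on the ratio of gap to
    sum. That ratio is a hypothesis so that the lemma can serve inside the induction of
    [chain_invariant]. *)
Lemma sum_gf_cons_err l ls : admissible l -> wnorm y (gap_gf ls) <= 5 / 4 * (sum_gf ls).[y] ->
  `|(sum_gf (l :: ls)).[y] - B.[y] * (sum_gf ls).[y]| <= (1 - y) ^+ 2 / 320 * (sum_gf ls).[y].
Proof.
move=> adml us; have [l1 u2] := (admissible_norm adml, horner_le_wnorm (gap_gf ls) y_ge0).
have u1 : `|(gap_gf ls).[y]| <= 5 / 4 * (sum_gf ls).[y] by apply: le_trans us.
have -> : (sum_gf (l :: ls)).[y] - B.[y] * (sum_gf ls).[y] =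
    l * eps * (1 - y) ^+ 2 * (gap_gf ls).[y].
  by rewrite sum_gf_cons hornerD hornerM hornerZ hornerM horner_1X2; ring.
rewrite [`|_ * (gap_gf ls).[y]|]normrM [`|_ * (1 - y) ^+ 2|]normrM [`|l * _|]normrM.
rewrite (gtr0_norm eps_gt0) (ger0_norm (sqr_ge0 _)).
have l3 : `|l| <= 1 / 100 by rewrite ler_norml l1.
have e0 := ltW eps_gt0; have w0 := sqr_ge0 (1 - y); have n0 := normr_ge0 l.
have -> : (1 - y) ^+ 2 / 320 * (sum_gf ls).[y] =
    1 / 100 * (1 / 4) * (1 - y) ^+ 2 * (5 / 4 * (sum_gf ls).[y]) by field.
apply: (ler_pM _ _ _ u1) => //; first exact: (mulr_ge0 (mulr_ge0 n0 e0) w0).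
by apply: ler_wpM2r => //; exact: (ler_pM n0 e0 l3 eps_le).
Qed.

(** The two claims feed each other. A ratio of at most 5/4 keeps the next sum above 83/100 of the
    current one, and the next gap is at most 1 + (1/100) (6/5) (5/4) = 1.015 times the current sum,
    below (5/4) (83/100). *)
Lemma chain_invariant ls : all admissible ls ->
  0 < (sum_gf ls).[y] /\ wnorm y (gap_gf ls) <= 5 / 4 * (sum_gf ls).[y].
Proof.
have /andP[b1 b2] := horner_bern_bnd.
elim: ls => [_|l ls IHls /andP[adml admls]] /=.
  rewrite /sum_gf /gap_gf /=; split; first by lra.
  have -> : wnorm y 1 = 1.
    by rewrite wnorm_nneg ?hornerC // => i; rewrite coef1 ler0n.
  by lra.
have [s0 us] := IHls admls.
have s'1 : 83 / 100 * (sum_gf ls).[y] <= (sum_gf (l :: ls)).[y].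
  have := sum_gf_cons_err adml us; rewrite ler_norml => /andP[+ _].
  have := ler_wpM2r (ltW s0) b1; have := ler_wpM2r (ltW s0) sqr_1By_le; lra.
split; first by lra.
rewrite gap_gf_cons; apply: (le_trans (wnormD _ _ y_ge0)).
rewrite (wnorm_nneg _ (nnegp_sum_gf admls)) wnormZ.
have : `|l| * wnorm y (bernc * gap_gf ls) <= 1 / 100 * (6 / 5 * (5 / 4 * (sum_gf ls).[y])).
  apply: ler_pM; rewrite ?wnorm_ge0 //; first by case/andP: adml.
  apply: (le_trans (wnormM _ _ y_ge0)); apply: ler_pM; rewrite ?wnorm_ge0 //.
  exact: wnorm_bernc.
by move=> Hu; lra.
Qed.

Lemma sum_gf_gt0 ls : all admissible ls -> 0 < (sum_gf ls).[y].
Proof. by case/chain_invariant. Qed.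

Lemma wnorm_gap_gf ls : all admissible ls -> wnorm y (gap_gf ls) <= 5 / 4 * (sum_gf ls).[y].
Proof. by case/chain_invariant. Qed.

Lemma sum_gf_cons_bnd l ls : admissible l -> all admissible ls ->
  `|(sum_gf (l :: ls)).[y] - B.[y] * (sum_gf ls).[y]| <= (1 - y) ^+ 2 / 320 * (sum_gf ls).[y].
Proof. by move=> adml admls; apply: sum_gf_cons_err => //; exact: wnorm_gap_gf. Qed.

Lemma sum_gf_cons_ge l ls : admissible l -> all admissible ls ->
  83 / 100 * (sum_gf ls).[y] <= (sum_gf (l :: ls)).[y].
Proof.
move=> adml admls; have s0 := sum_gf_gt0 admls; have /andP[b1 _] := horner_bern_bnd.
have := sum_gf_cons_bnd adml admls; rewrite ler_norml => /andP[+ _].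
by have := ler_wpM2r (ltW s0) b1; have := ler_wpM2r (ltW s0) sqr_1By_le; lra.
Qed.

Lemma start_gf_near_sum_gf ls a : all admissible ls ->
  `|(start_gf ls a).[y] - (sum_gf ls).[y]| <= (1 - pr a) / 4 * (sum_gf ls).[y].
Proof.
move=> admls; have [s0 us] := chain_invariant admls.
have u1 := le_trans (horner_le_wnorm (gap_gf ls) y_ge0) us.
have -> : (start_gf ls a).[y] - (sum_gf ls).[y] =
    (if a then - p0 else p1) * ((1 - y) * (gap_gf ls).[y]).
  rewrite start_gfE hornerD addrAC subrr add0r hornerZ hornerM; congr (_ * (_ * _)).
  by rewrite hornerD hornerN hornerX hornerC.
have -> : (1 - pr a) / 4 * (sum_gf ls).[y] = (1 - pr a) * (1 / 5 * (5 / 4 * (sum_gf ls).[y])).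
  by field.
rewrite normrM; have -> : `|if a then - p0 else p1| = 1 - pr a.
  by rewrite -p01; case: a => /=; rewrite ?addrK ?normrN gtr0_norm // addrC addKr.
have q0 : 0 <= 1 - pr a.
  by rewrite subr_ge0 ltW ?pr_lt1.
apply: ler_wpM2l => //; rewrite normrM; apply: ler_pM => //.
by case/andP: y_bnd => ? ?; rewrite ler_norml; apply/andP; split; lra.
Qed.

(* Three steps of the chain pass through the majority state [h] at both ends of
   the middle step, whatever the initial state, with probability bounded below;
   the middle variable is then almost a fresh Bernoulli one. *)
Section Hub.
Context (h : bool) (h_major : 1 / 2 <= pr h).

Lemma trans_hub l a : admissible l -> 495 / 1000 <= trans l a h.
Proof.
move=> /admissible_norm /andP[l1 l2]; rewrite /trans.
have : pr h <= 1 by exact/ltW/pr_lt1.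
by move: h_major; case: eqVneq => _ /= h1 h2; nra.
Qed.

(** The middle state of a round trip from the hub is almost a fresh sample: one factor supplies
    [pr c], the other is about [pr h >= 1/2], and 99/100 times 495/1000 exceeds 49/100. *)
Lemma trans_middle l l' c : admissible l -> admissible l' ->
  49 / 100 * pr c <= trans l h c * trans l' c h.
Proof.
move=> /admissible_norm /andP[l1 l2] /admissible_norm /andP[l3 l4].
have h1 : pr h <= 1 by exact/ltW/pr_lt1.
rewrite /trans; have [->|ne] := eqVneq c h.
  move: h_major => h2; rewrite /= !mulr1.
  have e1 : 99 / 100 * pr h <= l + (1 - l) * pr h by nra.
  have e2 : 99 / 100 * pr h <= l' + (1 - l') * pr h by nra.
  have e3 : 0 <= 99 / 100 * pr h by lra.
  by have := ler_pM e3 e3 e1 e2; nra.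
rewrite !mulr0 !add0r.
have e1 : 99 / 100 * pr c <= (1 - l) * pr c by apply: ler_wpM2r; [exact/ltW/pr_gt0 | lra].
have e2 : 495 / 1000 <= (1 - l') * pr h by move: h_major => h2; nra.
have e3 : 0 <= 99 / 100 * pr c by rewrite mulr_ge0 ?(ltW (pr_gt0 _)) //; lra.
have e4 : 0 <= 495 / 1000 :> R by lra.
by have := ler_pM e3 e4 e1 e2; have := pr_gt0 c; lra.
Qed.

Lemma horner_start_gf_cons l ls a :
  (start_gf (l :: ls) a).[y] = y ^+ a * \sum_b trans l a b * (start_gf ls b).[y].
Proof.
rewrite /= hornerM hornerXn horner_sum; congr (_ * _).
by apply: eq_bigr => b _; rewrite hornerZ.
Qed.

Lemma exp_state_bnd (a : bool) : 5 / 6 <= y ^+ a <= 6 / 5.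
Proof. by case: a; rewrite ?expr1 // expr0; apply/andP; split; lra. Qed.

Lemma horner_start_gf_cons_le l ls a M : admissible l -> 0 <= M ->
  (forall b, (start_gf ls b).[y] <= M) -> (start_gf (l :: ls) a).[y] <= y ^+ a * M.
Proof.
move=> adml M0 le_M; rewrite horner_start_gf_cons ler_wpM2l ?exprn_ge0 //.
rewrite -[leRHS]mul1r -(trans_sum l a) mulr_suml; apply: ler_sum => b _.
by rewrite ler_wpM2l ?admissible_trans.
Qed.

(** The weights are arbitrary, so that the hub path can be subtracted from those of the chain. [d]
    contributes no power of X because [F d] already counts it. *)
Definition sum3 (w : bool -> bool -> bool -> R) (a : bool) (F : bool -> {poly R}) :=
  \sum_b \sum_c \sum_d w b c d *: ('X^(a + b + c) * F d).

Lemma start_gf3 l1 l2 l3 ls a : start_gf [:: l1, l2, l3 & ls] a =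
  sum3 (fun b c d => trans l1 a b * trans l2 b c * trans l3 c d) a (start_gf ls).
Proof.
rewrite /sum3 /= mulr_sumr; apply: eq_bigr => b _.
rewrite mulr_sumr scaler_sumr mulr_sumr; apply: eq_bigr => c _.
rewrite mulr_sumr !scaler_sumr mulr_sumr scaler_sumr mulr_sumr; apply: eq_bigr => d _.
by rewrite -!scalerAr !scalerA !exprD !mulrA.
Qed.

Lemma sum3D w w' a F :
  sum3 (fun b c d => w b c d + w' b c d) a F = sum3 w a F + sum3 w' a F.
Proof. 
rewrite /sum3 -big_split; apply: eq_bigr => b _; rewrite -big_split.
apply: eq_bigr => c _; rewrite -big_split; apply: eq_bigr => d _.
by rewrite scalerDl.
Qed.

Lemma sum3_hub k a F :
  sum3 (fun b c d => k * pr c * ((b == h) && (d == h))%:R) a F =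
  k *: ('X^(a + h) * (B * F h)).
Proof.
rewrite /sum3 !big_bool /bern -!mul_polyC; case: (h) => /=.
  rewrite !(mulr0, mulr1, polyC0, polyCM, exprD, expr0, expr1).
  by move: (F true) (F false) ('X^a) (k%:P) => *; ring.
rewrite !(mulr0, mulr1, polyC0, polyCM, exprD, expr0, expr1).
by move: (F true) (F false) ('X^a) (k%:P) => *; ring.
Qed.

(** [j] counts the independent Bernoulli variables already extracted from the walk. *)
Definition diff2_norm j f := wnorm y ((1 - 'X) ^+ 2 * B ^+ j * f).

Lemma diff2_norm_sum3 j w a F K : (forall b c d, 0 <= w b c d) ->
  (forall d, diff2_norm j (F d) <= K * (F d).[y]) ->
  diff2_norm j (sum3 w a F) <= K * (sum3 w a F).[y].
Proof.
move=> w0 leF; rewrite /diff2_norm /sum3 mulr_sumr horner_sum mulr_sumr.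
apply: (le_trans (wnorm_sum _ _ y_ge0)); apply: ler_sum => b _.
rewrite mulr_sumr horner_sum mulr_sumr.
apply: (le_trans (wnorm_sum _ _ y_ge0)); apply: ler_sum => c _.
rewrite mulr_sumr horner_sum mulr_sumr.
apply: (le_trans (wnorm_sum _ _ y_ge0)); apply: ler_sum => d _.
rewrite -scalerAr wnormZ (ger0_norm (w0 _ _ _)) hornerZ [leRHS]mulrCA ler_wpM2l //.
rewrite [X in wnorm y X]mulrCA wnormMXn hornerM hornerXn [leRHS]mulrCA.
by rewrite ler_wpM2l ?exprn_ge0 // leF.
Qed.

(** Apart from the common factor y^a, the left side is at most (6/5)^2 (5/4) = 9/5 times the sum,
    and the right side at least 13 (24/100) (5/6)^2 (7/8), about 1.896 times it. *)
Lemma hub_mass l1 l2 l3 ls a :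
  admissible l1 -> admissible l2 -> admissible l3 -> all admissible ls ->
  (start_gf [:: l1, l2, l3 & ls] a).[y] <=
    13 * (24 / 100 * (y ^+ (a + h) * (B.[y] * (start_gf ls h).[y]))).
Proof.
move=> adm1 adm2 adm3 admls; have s0 := sum_gf_gt0 admls; set s := (sum_gf ls).[y] in s0.
have leF b : (start_gf ls b).[y] <= 5 / 4 * s.
  have := start_gf_near_sum_gf b admls; rewrite ler_norml -/s => /andP[_].
  by have := mulr_gt0 (pr_gt0 b) s0; lra.
have le1 b : (start_gf (l3 :: ls) b).[y] <= 6 / 5 * (5 / 4 * s).
  apply: (le_trans (horner_start_gf_cons_le b adm3 _ leF)); first by lra.
  by apply: ler_wpM2r; [lra | case/andP: (exp_state_bnd b)].
have le2 b : (start_gf [:: l2, l3 & ls] b).[y] <= 6 / 5 * (6 / 5 * (5 / 4 * s)).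
  apply: (le_trans (horner_start_gf_cons_le b adm2 _ le1)); first by lra.
  by apply: ler_wpM2r; [lra | case/andP: (exp_state_bnd b)].
apply: (le_trans (horner_start_gf_cons_le a adm1 _ le2)); first by lra.
have geF : 7 / 8 * s <= (start_gf ls h).[y].
  have := start_gf_near_sum_gf h admls; rewrite ler_norml -/s => /andP[+ _].
  by have := ler_wpM2r (ltW s0) h_major; lra.
have /andP[b1 _] := horner_bern_bnd; have /andP[h1 _] := exp_state_bnd h.
have -> : 13 * (24 / 100 * (y ^+ (a + h) * (B.[y] * (start_gf ls h).[y]))) =
    y ^+ a * (13 * (24 / 100) * (y ^+ h * (B.[y] * (start_gf ls h).[y]))).
  by rewrite exprD; ring.
rewrite ler_wpM2l ?exprn_ge0 //.
have g0 : 0 <= 7 / 8 * s by lra.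
have c0 : 0 <= 5 / 6 :> R by lra.
have := ler_pM c0 (mulr_ge0 c0 g0) h1 (ler_pM c0 g0 b1 geF).
by move: s0; lra.
Qed.

(* [25] comes from the mass [1 / 13] of the hub path: mixing [1 / z] and
   [1 / (z + 1)] with weights [12 / 13] and [1 / 13] stays below
   [1 / (z + 1 / 25)] for [z >= 1]. *)
Definition smoothing_bound j m : R := 2 * y / ((j.+1%:R + m%:R / 25) * eps) + (1 - y) ^+ 2.

Lemma smoothing_bound_step j m :
  smoothing_bound j m - (smoothing_bound j m - smoothing_bound j.+1 m) / 13 <= smoothing_bound j m.+1.
Proof.
rewrite /smoothing_bound; have e0 := eps_gt0.
set z := j.+1%:R + m%:R / 25.
have z1 : 1 <= z by rewrite /z -natr1; have := ler0n R j; have := ler0n R m; lra.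
have -> : j.+2%:R + m%:R / 25 = z + 1 by rewrite /z -[j.+2%:R]natr1; ring.
have -> : j.+1%:R + m.+1%:R / 25 = z + 1 / 25 by rewrite /z -[m.+1%:R]natr1; ring.
rewrite -subr_ge0.
have -> : 2 * y / ((z + 1 / 25) * eps) + (1 - y) ^+ 2 -
  (2 * y / (z * eps) + (1 - y) ^+ 2 -
   (2 * y / (z * eps) + (1 - y) ^+ 2 - (2 * y / ((z + 1) * eps) + (1 - y) ^+ 2)) / 13) =
  2 * y * (12 * z - 12) / (25 * 13 * z * (z + 1) * (z + 1 / 25) * eps).
  by field; rewrite ?mulf_neq0 ?lt0r_neq0 //; lra.
have z12 : 0 <= 12 * z - 12 by lra.
rewrite divr_ge0 // mulr_ge0 ?(ltW e0) ?ler0n //; first exact: mulr_ge0.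
by rewrite !mulr_ge0 //; lra.
Qed.

(** Induction on blocks of three steps, for all [j] at once. The hub path trades its block for one
    more factor B and so enjoys the bound at [j + 1]; the remaining paths keep nonnegative weights
    and the bound at [j]. As the bound decreases in [j], a lower bound on the hub mass is enough. *)
Lemma smoothing m ls : (3 * m <= size ls)%N -> all admissible ls -> forall j a,
  diff2_norm j (start_gf ls a) <= smoothing_bound j m * B.[y] ^+ j * (start_gf ls a).[y].
Proof.
have /andP[b1 _] := horner_bern_bnd.
have b0 k : 0 <= B.[y] ^+ k by apply: exprn_ge0; lra.
elim: m ls => [|m IHm] ls.
  move=> _ admls j a; apply: (le_trans (wnormM _ _ y_ge0)).
  have hy := wnorm_nneg y (nnegp_start_gf a admls).
  rewrite hy ler_wpM2r -?{1}hy ?wnorm_ge0 // [leRHS]mulrC.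
  by have := wnorm_diff2_bern p0_gt0 p1_gt0 p01 j y_gt0; rewrite /smoothing_bound mul0r addr0.
case: ls => [|l1 [|l2 [|l3 ls]]] le_m adm_all j a;
  do ?[by exfalso; move: le_m; rewrite mulnS].
have /and4P[adm1 adm2 adm3 admls] :
    [&& admissible l1, admissible l2, admissible l3 & all admissible ls] by [].
have {}IHm : forall j a,
    diff2_norm j (start_gf ls a) <= smoothing_bound j m * B.[y] ^+ j * (start_gf ls a).[y].
  by apply: IHm => //; move: le_m; rewrite mulnS.
pose w b c d := trans l1 a b * trans l2 b c * trans l3 c d.
(* 24/100 lies below 49/100 times 495/1000, so [w - w0] stays nonnegative. *)
pose w0 b c d := 24 / 100 * pr c * ((b == h) && (d == h))%:R.
set f := start_gf _ a; set Fh := (start_gf ls h).[y].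
pose T := 24 / 100 * (y ^+ (a + h) * (B.[y] * Fh)).
have fE : f = sum3 (fun b c d => w b c d - w0 b c d) a (start_gf ls) +
    (24 / 100) *: ('X^(a + h) * (B * start_gf ls h)).
  rewrite -sum3_hub -sum3D /f start_gf3 /sum3; apply: eq_bigr => b _.
  by apply: eq_bigr => c _; apply: eq_bigr => d _; rewrite subrK.
have fy : (sum3 (fun b c d => w b c d - w0 b c d) a (start_gf ls)).[y] = f.[y] - T.
  by rewrite fE hornerD hornerZ hornerM hornerXn hornerM addrK.
have ww0 b c d : 0 <= w b c d - w0 b c d.
  rewrite subr_ge0 /w /w0; have [->|_] := eqVneq b h; have [->|_] := eqVneq d h;
    rewrite /= ?mulr0 ?mulr1 ?mulr_ge0 ?admissible_trans //.
  rewrite -mulrA; have := trans_hub a adm1; have := trans_middle c adm2 adm3.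
  have c0 : 0 <= 495 / 1000 :> R by lra.
  have g0 : 0 <= 49 / 100 * pr c by rewrite mulr_ge0 ?(ltW (pr_gt0 c)) //; lra.
  by move=> t1 t2; have := ler_pM c0 g0 t2 t1; have := pr_gt0 c; lra.
have le1 := @diff2_norm_sum3 j _ a _ _ ww0 (IHm j).
have le2 : diff2_norm j ((24 / 100) *: ('X^(a + h) * (B * start_gf ls h))) <=
    smoothing_bound j.+1 m * B.[y] ^+ j * T.
  have -> : smoothing_bound j.+1 m * B.[y] ^+ j * T =
      24 / 100 * (y ^+ (a + h) * (smoothing_bound j.+1 m * B.[y] ^+ j.+1 * Fh)).
    by rewrite /T exprS; ring.
  rewrite /diff2_norm -scalerAr wnormZ ger0_norm; last by lra.
  rewrite [X in wnorm y X]mulrCA wnormMXn; apply: ler_wpM2l; first by lra.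
  apply: ler_wpM2l; first exact: exprn_ge0.
  by rewrite mulrA -[_ * B ^+ j * B]mulrA -exprSr; exact: IHm.
have hubT : f.[y] <= 13 * T by apply: hub_mass.
have f0 : 0 <= f.[y].
  by rewrite -(wnorm_nneg y (nnegp_start_gf a _)) ?wnorm_ge0 //= adm1 adm2 adm3.
have bound_dec : 0 <= smoothing_bound j m - smoothing_bound j.+1 m.
  rewrite /smoothing_bound; have e0 := eps_gt0; have m0 := ler0n R m; have j0 := ltr0Sn R j.
  have z0 : 0 < j.+1%:R + m%:R / 25 :> R by lra.
  have z1 : 0 < j.+2%:R + m%:R / 25 :> R by rewrite -[j.+2%:R]natr1; lra.
  rewrite subr_ge0 lerD2r ler_wpM2l ?mulr_ge0 // lef_pV2 ?posrE ?mulr_gt0 //.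
  by apply: ler_wpM2r; [exact: ltW | rewrite -[j.+2%:R]natr1; lra].
rewrite fE {1}/diff2_norm mulrDr; apply: (le_trans (wnormD _ _ y_ge0)).
apply: le_trans (lerD le1 le2) _; rewrite fy -fE -/f.
have -> : smoothing_bound j m * B.[y] ^+ j * (f.[y] - T) + smoothing_bound j.+1 m * B.[y] ^+ j * T =
  B.[y] ^+ j * (smoothing_bound j m * f.[y] - (smoothing_bound j m - smoothing_bound j.+1 m) * T) by ring.
rewrite [leRHS]mulrAC [leRHS]mulrC ler_wpM2l //.
have := ler_wpM2r f0 (smoothing_bound_step j m); have := ler_wpM2l bound_dec hubT; lra.
Qed.

(** With n steps, m = floor(n / 3) >= (n - 2) / 3, hence 1 + m / 25 >= (n + 73) / 75; this is the
    origin of 150 and 72. *)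
Lemma smoothing_sum_gf_hub ls : all admissible ls ->
  wnorm y ((1 - 'X) ^+ 2 * sum_gf ls) <=
    (150 * y / ((size ls).+1%:R + 72) / eps + (1 - y) ^+ 2) * (sum_gf ls).[y].
Proof.
move=> admls; pose m := (size ls %/ 3)%N.
have le_m : (3 * m <= size ls)%N by rewrite mulnC leq_trunc_div.
have le_bound : smoothing_bound 0 m <= 150 * y / ((size ls).+1%:R + 72) / eps + (1 - y) ^+ 2.
  have e0 := eps_gt0; rewrite /smoothing_bound lerD2r invfM mulrA ler_wpM2r ?invr_ge0 ?(ltW e0) //.
  have : (size ls)%:R <= 3 * m%:R + 2 :> R.
    rewrite -!natrM -natrD ler_nat mulnC {1}(divn_eq (size ls) 3) leq_add2l -ltnS.
    exact: ltn_pmod.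
  have m0 := ler0n R m; have s0 := ler0n R (size ls) => le_s.
  rewrite ler_pdivrMr; last by lra.
  rewrite mulrAC ler_pdivlMr; last by rewrite -natr1; lra.
  by rewrite -natr1; have := ler_wpM2l y_ge0 le_s; nra.
apply: (@le_trans _ _ (smoothing_bound 0 m * (sum_gf ls).[y])); last first.
  by rewrite ler_wpM2r // ltW // sum_gf_gt0.
rewrite sum_gfE mulr_sumr horner_sum mulr_sumr.
apply: (le_trans (wnorm_sum _ _ y_ge0)); apply: ler_sum => b _.
rewrite -scalerAr wnormZ hornerZ (gtr0_norm (pr_gt0 b)) mulrCA ler_wpM2l ?(ltW (pr_gt0 b)) //.
by have := smoothing le_m admls 0 b; rewrite /diff2_norm expr0 !mulr1.
Qed.

End Hub.
Lemma smoothing_sum_gf ls : all admissible ls ->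
  wnorm y ((1 - 'X) ^+ 2 * sum_gf ls) <=
    (150 * y / ((size ls).+1%:R + 72) / eps + (1 - y) ^+ 2) * (sum_gf ls).[y].
Proof.
have [h1|h1] := leP (1 / 2) p1; first exact: (@smoothing_sum_gf_hub true).
apply: (@smoothing_sum_gf_hub false); rewrite /pr.
by move: p01 h1; lra.
Qed.

(** The gap is the sum over the remaining steps plus a term damped by |l| <= 1/100, so it inherits
    the smoothness of the sum. The factor 13/10 pays for that term and for the loss 83/100 incurred
    when the bound is expressed through the longer walk. *)
Lemma smoothing_gap_gf ls : all admissible ls ->
  wnorm y ((1 - 'X) ^+ 2 * gap_gf ls) <=
    13 / 10 * (150 * y / ((size ls)%:R + 72) / eps + (1 - y) ^+ 2) * (sum_gf ls).[y].
Proof.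
have x0 := sqr_ge0 (1 - y); have e0 := eps_gt0.
have /andP[b1 _] := horner_bern_bnd.
elim: ls => [_|l ls IHls /andP[adml admls]].
  have := wnorm_diff2_bern p0_gt0 p1_gt0 p01 0 y_gt0; rewrite !expr0 mul1r.
  move=> le0; apply: (le_trans le0); rewrite add0r.
  have -> : 150 * y / 72 / eps = 150 / 72 * (y / eps) by ring.
  have -> : 2 * y / (1 * eps) = 2 * (y / eps) by rewrite mul1r; ring.
  have q0 : 0 < y / eps by rewrite divr_gt0.
  have := ler_wpM2l (ltW q0) b1; have := ler_wpM2l x0 b1.
  by rewrite /sum_gf /=; lra.
have s0 := sum_gf_gt0 admls; have s1 := sum_gf_cons_ge adml admls.
set n := size ls in IHls; rewrite [size _]/= -/n.
have D1 := smoothing_sum_gf admls; rewrite -/n in D1.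
set D := 150 * y / (n.+1%:R + 72) / eps + (1 - y) ^+ 2 in D1 *.
set D' := 150 * y / (n%:R + 72) / eps + (1 - y) ^+ 2 in IHls.
have n0 := ler0n R n; have n1 : n.+1%:R = n%:R + 1 :> R by rewrite natr1.
have D0 : 0 <= D.
  apply: addr_ge0 x0; apply: divr_ge0 (ltW e0); apply: divr_ge0.
    by apply: mulr_ge0 y_ge0; exact: ler0n.
  by rewrite n1; lra.
(* The shift of the length by one costs at most 73/72, its value at n = 0. *)
have DD' : D' <= 73 / 72 * D.
  rewrite /D /D' mulrDr lerD //; last by lra.
  rewrite mulrA ler_wpM2r ?invr_ge0 ?(ltW e0) // mulrA.
  rewrite ler_pdivrMr; last by lra.
  rewrite mulrAC ler_pdivlMr; last by lra.
  by rewrite n1; have := mulr_ge0 y_ge0 n0; lra.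
rewrite gap_gf_cons mulrDr -scalerAr; apply: (le_trans (wnormD _ _ y_ge0)).
have -> : (1 - 'X) ^+ 2 * (bernc * gap_gf ls) = bernc * ((1 - 'X) ^+ 2 * gap_gf ls).
  by rewrite mulrCA.
have : wnorm y (l *: (bernc * ((1 - 'X) ^+ 2 * gap_gf ls))) <=
    1 / 100 * (6 / 5 * (13 / 10 * (73 / 72 * D) * (sum_gf ls).[y])).
  rewrite wnormZ; apply: ler_pM; rewrite ?wnorm_ge0 //; first by case/andP: adml.
  apply: (le_trans (wnormM _ _ y_ge0)); apply: ler_pM; rewrite ?wnorm_ge0 //.
    exact: wnorm_bernc.
  apply: (le_trans (IHls admls)); rewrite ler_wpM2r ?(ltW s0) //.
  by rewrite ler_wpM2l //; lra.
by have := ler_wpM2l D0 s1; have := mulr_ge0 D0 (ltW s0); lra.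
Qed.

End Weighted.

(** * Reversibility, and changing the weight of one step *)

(** [chain_step l] is diag(1, l) followed by the matrix with rows [(B, eps (1 - X)^2)] and
    [(1, bernc)], which is self-adjoint for the form diag(1, eps (1 - X)^2). Transposing the product
    of the steps reverses their order. *)
Lemma foldr_chain_step ls a b :
  (foldr chain_step (B * a + eps *: ((1 - 'X) ^+ 2 * b), a + bernc * b) ls).1 =
  sum_gf (rev ls) * a + eps *: ((1 - 'X) ^+ 2 * (gap_gf (rev ls) * b)).
Proof.
elim/last_ind: ls a b => [|ls l IHls] a b.
  by rewrite /rev /= /sum_gf /gap_gf /= mul1r.
rewrite rev_rcons foldr_rcons.
have -> : chain_step l (B * a + eps *: ((1 - 'X) ^+ 2 * b), a + bernc * b) =
    (B * (B * a + eps *: ((1 - 'X) ^+ 2 * b)) +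
       eps *: ((1 - 'X) ^+ 2 * (l *: (a + bernc * b))),
     (B * a + eps *: ((1 - 'X) ^+ 2 * b)) + bernc * (l *: (a + bernc * b))).
  by rewrite /chain_step /= -!mul_polyC !polyCM; congr pair; ring.
rewrite {}IHls sum_gf_cons gap_gf_cons -!mul_polyC !polyCM.
by move: (sum_gf _) (gap_gf _) (bernc) => s u c; ring.
Qed.

(* The derivative of the generating function in the stickiness of a single step
   factors through the two halves of the walk; reversibility of the chain gives
   the reversed first half. *)
Lemma sum_gf_cat ls1 l ls2 : sum_gf (ls1 ++ l :: ls2) =
  sum_gf (rev ls1) * sum_gf ls2 + (l * eps) *: ((1 - 'X) ^+ 2 * (gap_gf (rev ls1) * gap_gf ls2)).
Proof.
rewrite {1}/sum_gf /chain foldr_cat /= -/(chain ls2).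
have -> : chain_step l (chain ls2) =
    (B * sum_gf ls2 + eps *: ((1 - 'X) ^+ 2 * (l *: gap_gf ls2)),
     sum_gf ls2 + bernc * (l *: gap_gf ls2)).
  by rewrite /chain_step /= -!mul_polyC !polyCM; congr pair; rewrite /sum_gf /gap_gf; ring.
rewrite foldr_chain_step; congr (_ + _).
by rewrite -!mul_polyC polyCM; move: (gap_gf _) => u; ring.
Qed.

Lemma sum_gf_rev ls : sum_gf (rev ls) = sum_gf ls.
Proof.
have := foldr_chain_step ls 1 0.
by rewrite !(mulr0, mulr1, scaler0, addr0) => <-.
Qed.

(** A step of weight 0 draws its target afresh from p, so an independent walk starts there. *)
Lemma sum_gf_glue ls1 ls2 : sum_gf (ls1 ++ 0 :: ls2) = sum_gf ls1 * sum_gf ls2.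
Proof. by rewrite sum_gf_cat mul0r scale0r addr0 sum_gf_rev. Qed.

Lemma admissible0 : admissible 0.
Proof.
apply/andP; split; first by rewrite normr0; lra.
apply/forallP => a; apply/forallP => b.
by rewrite /trans mul0r add0r subr0 mul1r ltW ?pr_gt0.
Qed.

Lemma sum_gf1 ls : (sum_gf ls).[1] = 1.
Proof.
elim: ls => [|l ls IHls]; first by rewrite /sum_gf /= horner_bern mulr1.
rewrite sum_gf_cons hornerD hornerM hornerZ hornerM horner_1X2 IHls horner_bern.
by rewrite subrr expr0n mul0r mulr0 addr0 !mulr1.
Qed.

(** The longer half carries [(1 - X)^2], the other gap costs 5/4. At y = 1 the factor p0 p1 cancels
    and leaves (13/10) 150 (5/4) = 975/4, to be doubled because the longer half, increased by 72, is
    at least half of the whole: 975/2 < 490. *)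
Lemma wnorm_switch ls1 l ls2 : admissible l -> all admissible ls1 -> all admissible ls2 ->
  wnorm 1 (sum_gf (ls1 ++ l :: ls2) - sum_gf (ls1 ++ 0 :: ls2)) <=
    `|l| * (490 / (size ls1 + size ls2 + 2)%:R).
Proof.
have longer (m n : nat) : (n <= m)%N -> (m + n + 2 <= 2 * (m + 72))%N by lia.
move=> adml adm1 adm2; rewrite sum_gf_glue sum_gf_cat sum_gf_rev addrAC subrr add0r.
have e0 := eps_gt0; have [n0 m0] := (ler0n R (size ls1), ler0n R (size ls2)).
have bnd1 : 5 / 6 <= (1 : R) <= 6 / 5 by apply/andP; split; lra.
have adm1' : all admissible (rev ls1) by rewrite all_rev.
rewrite wnormZ normrM (gtr0_norm e0) -mulrA ler_wpM2l //.
have base ls ls' : all admissible ls -> all admissible ls' ->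
    (size ls1 + size ls2 + 2 <= 2 * (size ls + 72))%N ->
    eps * wnorm 1 ((1 - 'X) ^+ 2 * gap_gf ls * gap_gf ls') <= 490 / (size ls1 + size ls2 + 2)%:R.
  move=> als als' le_s; have t0 : 0 < (size ls1 + size ls2 + 2)%:R :> R by rewrite ltr0n addn2.
  have := smoothing_gap_gf bnd1 als; have := wnorm_gap_gf bnd1 als'.
  rewrite !sum_gf1 !mulr1 subrr expr0n addr0 => u2 u1.
  have lenM := le_trans (wnormM ((1 - 'X) ^+ 2 * gap_gf ls) (gap_gf ls') (ler01 : 0 <= 1 :> R))
     (ler_pM (wnorm_ge0 _ ler01) (wnorm_ge0 _ ler01) u1 u2).
  apply: (le_trans (ler_wpM2l (ltW e0) lenM)).
  have k0 : 0 < (size ls)%:R + 72 :> R by have := ler0n R (size ls); lra.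
  have -> : eps * (13 / 10 * (150 / ((size ls)%:R + 72) / eps) * (5 / 4)) =
      975 / 4 / ((size ls)%:R + 72).
    by field; rewrite lt0r_neq0 ?(gt_eqF p0_gt0) ?(gt_eqF p1_gt0).
  rewrite ler_pdivrMr // mulrAC ler_pdivlMr //.
  have : (size ls1 + size ls2 + 2)%:R <= 2 * ((size ls)%:R + 72) :> R.
    by rewrite -natrD -natrM ler_nat.
  by lra.
have [le12|lt21] := leqP (size ls2) (size ls1).
  by rewrite mulrA; apply: base => //; rewrite size_rev; apply: longer.
rewrite [gap_gf (rev ls1) * _]mulrC mulrA; apply: base => //.
by rewrite [(size ls1 + _)%N]addnC; apply: longer; exact: ltnW.
Qed.

Definition glued l (ts : seq nat) : seq R := flatten [seq 0 :: nseq t.-1 l | t <- ts].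

Lemma sum_gf_glued l k ts : sum_gf (nseq k l ++ glued l ts) =
  sum_gf (nseq k l) * \prod_(t <- ts) sum_gf (nseq t.-1 l).
Proof.
elim: ts k => [|t ts IHts] k; first by rewrite /glued /= cats0 big_nil mulr1.
by rewrite /glued /= -/(glued l ts) sum_gf_glue IHts big_cons.
Qed.

(** Restoring the weight [l] at the leftmost 0 merges one piece into the prefix. The total length
    never changes, so every change has the same cost. *)
Lemma wnorm_glued l k ts : admissible l -> all (leq 1) ts ->
  wnorm 1 (sum_gf (nseq k l ++ glued l ts) - sum_gf (nseq (k + sumn ts) l)) <=
    (size ts)%:R * (`|l| * (490 / (k + sumn ts).+1%:R)).
Proof.
move=> adml; have adms j : all admissible (nseq j l) by rewrite all_nseq adml orbT.
have adm_glued us : all admissible (glued l us).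
  by elim: us => //= u us IHus; rewrite all_cat adms IHus admissible0.
elim: ts k => [|t ts IHts] k /=.
  by rewrite /glued /= cats0 addn0 subrr wnorm0 mul0r.
case/andP=> t0 ts0; rewrite /glued /= -/(glued l ts).
have szg us : all (leq 1) us -> size (glued l us) = sumn us.
  by elim: us => //= u us IHus /andP[u0 us0]; rewrite /= size_cat size_nseq IHus //; lia.
have := wnorm_switch (ls1 := nseq k l) (ls2 := nseq t.-1 l ++ glued l ts) adml (adms k).
rewrite all_cat adms adm_glued => /(_ isT).
rewrite size_cat !size_nseq szg //.
have -> : (k + (t.-1 + sumn ts) + 2 = (k + (t + sumn ts)).+1)%N by lia.
have -> : nseq k l ++ l :: nseq t.-1 l ++ glued l ts = nseq (k + t) l ++ glued l ts.
  by rewrite -{2}(prednK t0) nseqD -catA.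
have := IHts (k + t)%N ts0; rewrite addnA => le1 le2.
have tri (f f' f'' : {poly R}) : wnorm 1 (f - f'') <= wnorm 1 (f - f') + wnorm 1 (f' - f'').
  by rewrite -[f - f''](subrKA f') wnormD ?ler01.
rewrite -natr1 mulrDl mul1r; apply: le_trans (lerD le1 le2).
by rewrite [leRHS]addrC -[X in _ <= X + _]wnormN opprB; exact: tri.
Qed.

Lemma wnorm_prod_sum_gf l t0 ts : admissible l -> all (leq 1) (t0 :: ts) ->
  wnorm 1 (\prod_(t <- t0 :: ts) sum_gf (nseq t.-1 l) - sum_gf (nseq (sumn (t0 :: ts)).-1 l)) <=
    (size ts)%:R * (`|l| * (490 / (sumn (t0 :: ts))%:R)).
Proof.
move=> adml /= /andP[t1 ts1]; rewrite big_cons -sum_gf_glued.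
have := wnorm_glued t0.-1 adml ts1.
have -> : (t0.-1 + sumn ts = (t0 + sumn ts).-1)%N by lia.
by rewrite prednK //; lia.
Qed.

(** Telescoping over the walks whose first steps resample and whose later steps have weight [l]; the
    term [i] switches the step that is followed by [i] others. *)
Lemma sum_gf_sub_binomial l n : sum_gf (nseq n l) - B ^+ n.+1 =
  \sum_(i < n) (l * eps) *: (B ^+ (n - i.+1) * ((1 - 'X) ^+ 2 * gap_gf (nseq i l))).
Proof.
elim: n => [|n IHn]; first by rewrite big_ord0 /sum_gf /= expr1 subrr.
rewrite big_ord_recr /= subnn expr0 mul1r sum_gf_cons addrAC; congr (_ + _).
rewrite exprS -mulrBr IHn mulr_sumr; apply: eq_bigr => i _.
by rewrite -scalerAr; congr (_ *: _); rewrite mulrA -exprS subnSK.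
Qed.

(** * Comparison with the binomial law in the weighted norm *)

Section BinomialComparison.
Context (y : R) (y_bnd : 5 / 6 <= y <= 6 / 5).
Let y_gt0 : 0 < y. Proof. by case/andP: y_bnd => + _; apply: lt_le_trans; lra. Qed.

Lemma sum_gf_growth l n : admissible l ->
  (sum_gf (nseq n l)).[y] <= (B.[y] + (1 - y) ^+ 2 / 320) ^+ n.+1.
Proof.
move=> adml; have adms j : all admissible (nseq j l) by rewrite all_nseq adml orbT.
have x0 := sqr_ge0 (1 - y); have /andP[b1 _] := horner_bern_bnd y_bnd.
elim: n => [|n IHn]; first by rewrite expr1 /sum_gf /=; lra.
have := sum_gf_cons_bnd y_bnd adml (adms n); rewrite ler_norml => /andP[_ le_s].
have -> : nseq n.+1 l = l :: nseq n l by [].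
rewrite exprS; apply: le_trans (ler_wpM2l _ IHn); last by lra.
by rewrite mulrDl; lra.
Qed.

(** In each term either [B^j] or the gap covers about half of the walk, and that factor absorbs
    [(1 - X)^2]. The gap case dictates the constants: 390 = 2 (13/10) 150, and 13/40 is 13/10 times
    the bound 1/4 on p0 p1. *)
Lemma wnorm_sum_gf_sub_binomial l n : admissible l ->
  wnorm y (sum_gf (nseq n l) - B ^+ n.+1) <=
    `|l| * ((B.[y] + (1 - y) ^+ 2 / 320) ^+ n * (390 * y + 13 / 40 * (1 - y) ^+ 2 * n.+1%:R)).
Proof.
have longer (i m : nat) : (i < m)%N -> (2 * (m - i.+1).+1 < m.+1)%N ->
  (m.+1 <= 2 * (i + 72))%N by lia.
move=> adml; have adms j : all admissible (nseq j l) by rewrite all_nseq adml orbT.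
have x0 := sqr_ge0 (1 - y); have /andP[b1 _] := horner_bern_bnd y_bnd.
have e0 := eps_gt0; have y0 := ltW y_gt0.
set beta := B.[y] + _; set x2 := (1 - y) ^+ 2 in x0 beta *.
have b_beta : B.[y] <= beta by rewrite /beta; lra.
have beta0 : 0 < beta by lra.
pose E := 390 * (y / n.+1%:R) + 13 / 40 * x2.
have n0 : 0 < n.+1%:R :> R by rewrite ltr0n.
have E0 : 0 <= E.
  apply: addr_ge0; last by apply: mulr_ge0 x0; lra.
  by apply: mulr_ge0; [exact: ler0n | exact: divr_ge0 y0 (ltW n0)].
have term i : (i < n)%N ->
    wnorm y (B ^+ (n - i.+1) * ((1 - 'X) ^+ 2 * gap_gf (nseq i l))) * eps <= beta ^+ n * E.
  move=> lt_in; set s := (sum_gf (nseq i l)).[y]; set j := (n - i.+1)%N.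
  have s0 : 0 < s by apply: sum_gf_gt0.
  have bj : 0 <= B.[y] ^+ j by apply: exprn_ge0; lra.
  have le_s : B.[y] ^+ j * s <= beta ^+ n.
    have -> : n = (j + i.+1)%N by rewrite subnK.
    rewrite exprD; apply: ler_pM => //; first exact: ltW.
      by rewrite lerXn2r ?nnegrE // ltW // (lt_le_trans _ b1) //; lra.
    exact: sum_gf_growth.
  suff [K K0 [leK leE]] : exists2 K, 0 <= K &
      wnorm y (B ^+ j * ((1 - 'X) ^+ 2 * gap_gf (nseq i l))) <= B.[y] ^+ j * s * K /\ K * eps <= E.
    have : B.[y] ^+ j * s * (K * eps) <= beta ^+ n * E.
      by apply: ler_pM => //; rewrite ?mulr_ge0 // ltW.
    by apply: le_trans; rewrite [leRHS]mulrA; apply: ler_wpM2r => //; exact: ltW.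
  have eps4 : eps * x2 <= 1 / 4 * x2 by rewrite ler_wpM2r // eps_le.
  have [le_t|lt_t] := leqP n.+1 (2 * j.+1).
    exists ((2 * y / (j.+1%:R * eps) + x2) * (5 / 4)).
      apply: mulr_ge0; last by lra.
      by apply: addr_ge0 => //; rewrite divr_ge0 ?mulr_ge0 ?ler0n ?(ltW p0_gt0) ?(ltW p1_gt0).
    split.
      rewrite [X in wnorm y X]mulrA [X in wnorm y (X * _)]mulrC; apply: (le_trans (wnormM _ _ y0)).
      have -> : B.[y] ^+ j * s * ((2 * y / (j.+1%:R * eps) + x2) * (5 / 4)) =
        (B.[y] ^+ j * (2 * y / (j.+1%:R * eps) + x2)) * (5 / 4 * s) by ring.
      apply: ler_pM; rewrite ?wnorm_ge0 //; first exact: wnorm_diff2_bern.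
      exact: wnorm_gap_gf.
    have j0 : 0 < j.+1%:R :> R by rewrite ltr0n.
    have -> : (2 * y / (j.+1%:R * eps) + x2) * (5 / 4) * eps =
        5 / 2 * (y / j.+1%:R) + 5 / 4 * (eps * x2).
      by field; rewrite nat1r lt0r_neq0 ?(gt_eqF p0_gt0) ?(gt_eqF p1_gt0).
    have : y / j.+1%:R <= 2 * (y / n.+1%:R).
      rewrite mulrA.
      rewrite ler_pdivrMr // [leRHS]mulrAC ler_pdivlMr // [2 * y]mulrC.
      rewrite -[leRHS]mulrA; apply: ler_wpM2l => //.
      by rewrite -natrM ler_nat.
    have : 0 <= y / n.+1%:R by rewrite divr_ge0 // ltW.
    by rewrite /E; move: (y / _) (y / _) (eps * x2) (x2) eps4 x0 => q q' ex x; lra.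
  have i0 : 0 < i%:R + 72 :> R by have := ler0n R i; lra.
  exists (13 / 10 * (150 * y / (i%:R + 72) / eps + x2)).
    apply: mulr_ge0; first by lra.
    apply: addr_ge0 x0; apply: divr_ge0 (ltW e0); apply: divr_ge0 (ltW i0).
    by apply: mulr_ge0 y0; exact: ler0n.
  split.
    apply: (le_trans (wnormM _ _ y0)); rewrite -[leRHS]mulrA.
    have -> : wnorm y (B ^+ j) = B.[y] ^+ j.
      by rewrite wnorm_nneg ?horner_exp //; apply/nnegpX/nnegp_bern.
    rewrite ler_wpM2l // [leRHS]mulrC.
    by have := smoothing_gap_gf y_bnd (adms i); rewrite size_nseq.
  have -> : 13 / 10 * (150 * y / (i%:R + 72) / eps + x2) * eps =
      195 * (y / (i%:R + 72)) + 13 / 10 * (eps * x2).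
    by field; rewrite lt0r_neq0 ?(gt_eqF p0_gt0) ?(gt_eqF p1_gt0).
  have : y / (i%:R + 72) <= 2 * (y / n.+1%:R).
    rewrite mulrA.
    rewrite ler_pdivrMr // [leRHS]mulrAC ler_pdivlMr // [2 * y]mulrC.
    rewrite -[leRHS]mulrA; apply: ler_wpM2l => //.
    have : n.+1%:R <= 2 * (i + 72)%:R :> R by rewrite -natrM ler_nat longer.
    by rewrite natrD.
  have : 0 <= y / n.+1%:R by rewrite divr_ge0 // ltW.
  by rewrite /E; move: (y / _) (y / _) (eps * x2) (x2) eps4 x0 => q q' ex x; lra.
rewrite sum_gf_sub_binomial; apply: (le_trans (wnorm_sum _ _ y0)).
apply: (@le_trans _ _ (\sum_(i < n) `|l| * (beta ^+ n * E))).
  apply: ler_sum => i _; rewrite wnormZ normrM (gtr0_norm e0) -mulrA ler_wpM2l //.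
  by rewrite mulrC term.
rewrite sumr_const card_ord -[_ *+ n]mulr_natr.
have -> : `|l| * (beta ^+ n * E) * n%:R = `|l| * (beta ^+ n * (E * n%:R)) by ring.
apply: ler_wpM2l => //; apply: ler_wpM2l; first exact/exprn_ge0/ltW.
apply: (@le_trans _ _ (E * n.+1%:R)); first by rewrite ler_wpM2l // ler_nat.
by rewrite /E mulrA mulrDl divfK ?lt0r_neq0.
Qed.

End BinomialComparison.

End StickyChain.

(** * Mean and variance *)

Section Moments.
Context {R : realFieldType} (p0 p1 : R).
Context (p0_gt0 : 0 < p0) (p1_gt0 : 0 < p1) (p01 : p0 + p1 = 1).

Local Notation sum_gf := (sum_gf p0 p1).
Local Notation gap_gf := (gap_gf p0 p1).
Local Notation eps := (p0 * p1).

Lemma gap_gf1_cons l ls : (gap_gf (l :: ls)).[1] = 1 + l * (gap_gf ls).[1].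
Proof.
rewrite gap_gf_cons hornerD hornerZ hornerM sum_gf1 // /bernc hornerD hornerC hornerZ hornerX.
by rewrite mulr1 [p1 + _]addrC p01 mul1r.
Qed.

Lemma deriv_sum_gf1 ls : (sum_gf ls)^`().[1] = p1 * (size ls).+1%:R.
Proof.
elim: ls => [|l ls IHls]; first by rewrite /sum_gf /= deriv_bern hornerC mulr1.
rewrite sum_gf_cons expr2 -mulrA.
rewrite !(derivD, derivZ, derivM, derivN, derivX, derivC, deriv_bern).
rewrite !(hornerD, hornerM, hornerZ, hornerN, hornerC, hornerX) ?horner_bern IHls sum_gf1 //=.
rewrite -[(size ls).+2%:R]natr1.
by have -> : p0 = 1 - p1; [rewrite -p01 addrK | ring].
Qed.

Lemma deriv2_sum_gf1_cons l ls : (sum_gf (l :: ls))^`()^`().[1] =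
  (sum_gf ls)^`()^`().[1] + 2 * p1 * (sum_gf ls)^`().[1] + 2 * (l * eps) * (gap_gf ls).[1].
Proof.
have -> : sum_gf (l :: ls) = bern p0 p1 * sum_gf ls +
    (l * eps) *: ((1 - 'X) * ((1 - 'X) * gap_gf ls)).
  by rewrite sum_gf_cons expr2 -mulrA.
rewrite !(derivD, derivZ, derivM, derivN, derivX, derivC, deriv_bern).
rewrite !(hornerD, hornerM, hornerZ, hornerN, hornerC, hornerX) ?horner_bern.
by have -> : p0 = 1 - p1; [rewrite -p01 addrK | ring].
Qed.

(** The gap at 1 is a partial geometric sum in [l]. Multiplying the variance by [1 - l] avoids its
    closed form and isolates the term linear in the length. *)
Lemma variance_defect l n :
  (1 - l) * ((sum_gf (nseq n l))^`()^`().[1] + (sum_gf (nseq n l))^`().[1]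
     - (sum_gf (nseq n l))^`().[1] ^+ 2) =
  (1 + l) * eps * n.+1%:R - 2 * l * eps * (gap_gf (nseq n l)).[1].
Proof.
elim: n => [|n IHn].
  rewrite /sum_gf /gap_gf /= deriv_bern derivC !hornerC.
  by have -> : p0 = 1 - p1; [rewrite -p01 addrK | ring].
have -> : nseq n.+1 l = l :: nseq n l by [].
move: IHn; rewrite deriv2_sum_gf1_cons gap_gf1_cons !deriv_sum_gf1 /= !size_nseq.
set s2 := _^`()^`().[1]; set u := (gap_gf _).[1].
have -> : p0 = 1 - p1 by rewrite -p01 addrK.
by rewrite -[n.+2%:R]natr1; lra.
Qed.

End Moments.

(** * Energy decay on the unit circle *)

Section CharacteristicFunction.
Context {R : realType} (p0 p1 : R).
Context (p0_gt0 : 0 < p0) (p1_gt0 : 0 < p1) (p01 : p0 + p1 = 1).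

Local Notation sum_gf := (sum_gf p0 p1).
Local Notation gap_gf := (gap_gf p0 p1).
Local Notation B := (bern p0 p1).
Local Notation eps := (p0 * p1).

(* [s] and [(1 - X) u] are, up to [sqrt eps], the coordinates along the constants
   and along their orthogonal complement in l^2(p); a step acts on the latter with
   factor [l], so that [L tau] is the weight that makes the step a contraction. *)
Lemma energy_step (tau L a S U S' U' : R) :
  0 <= tau <= 1 -> 0 <= L <= 1 / 100 -> 0 <= a -> a ^+ 2 = 1 - tau ->
  0 <= S -> 0 <= U -> 0 <= S' <= a * S + L * tau * U -> 0 <= U' <= S + L * a * U ->
  S' ^+ 2 + L * tau * U' ^+ 2 <= (1 - 4 / 5 * tau) * (S ^+ 2 + L * tau * U ^+ 2).
Proof.
move=> /andP[t0 t1] /andP[L0 L1] a0 aE S0 U0 /andP[S'0 leS'] /andP[U'0 leU'].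
have a1 : a <= 1 by rewrite -(@ler_sqr _ a 1) ?nnegrE // aE expr1n; lra.
have Lt0 : 0 <= L * tau by rewrite mulr_ge0.
apply: (@le_trans _ _ ((a * S + L * tau * U) ^+ 2 + L * tau * (S + L * a * U) ^+ 2)).
  rewrite lerD // ?ler_wpM2l // ler_sqr ?nnegrE //;
  by rewrite ?addr_ge0 ?mulr_ge0.
have -> : (a * S + L * tau * U) ^+ 2 + L * tau * (S + L * a * U) ^+ 2 =
    a ^+ 2 * S ^+ 2 + 2 * a * S * U * L * tau * (1 + L) + L ^+ 2 * tau ^+ 2 * U ^+ 2
    + L * tau * S ^+ 2 + L ^+ 3 * tau * a ^+ 2 * U ^+ 2 by ring.
rewrite aE -subr_ge0.
have -> : (1 - 4 / 5 * tau) * (S ^+ 2 + L * tau * U ^+ 2) -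
  ((1 - tau) * S ^+ 2 + 2 * a * S * U * L * tau * (1 + L) + L ^+ 2 * tau ^+ 2 * U ^+ 2
    + L * tau * S ^+ 2 + L ^+ 3 * tau * (1 - tau) * U ^+ 2) =
  tau * (S ^+ 2 * (1 / 5 - L) - 2 * a * (S * U) * L * (1 + L)
     + L * U ^+ 2 * (1 - 4 / 5 * tau - L * tau - L ^+ 2 * (1 - tau))) by field.
apply: mulr_ge0 => //.
have h1 : a * (S * U) * L * (1 + L) <= 101 / 100 * (L * (S * U)).
  have SU0 : 0 <= L * (S * U) by rewrite !mulr_ge0.
  have -> : a * (S * U) * L * (1 + L) = a * (1 + L) * (L * (S * U)) by ring.
  by apply: ler_wpM2r => //; have := mulr_ge0 a0 L0; nra.
have h2 : 19 / 100 * S ^+ 2 <= S ^+ 2 * (1 / 5 - L).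
  by rewrite mulrC ler_wpM2l ?sqr_ge0 //; lra.
have h3 : 18 / 100 * (L * U ^+ 2) <=
    L * U ^+ 2 * (1 - 4 / 5 * tau - L * tau - L ^+ 2 * (1 - tau)).
  by rewrite mulrC ler_wpM2l ?mulr_ge0 ?sqr_ge0 //; nra.
have h4 : 19 * (L * S ^+ 2) <= 19 / 100 * S ^+ 2.
  by have := ler_wpM2r (sqr_ge0 S) L1; lra.
(* What remains is L (19 S^2 - 2.02 S U + 0.18 U^2) >= 0, which holds since 10.1 (S - U / 10)^2
   already accounts for the cross term. *)
have := mulr_ge0 L0 (sqr_ge0 (S - U / 10)).
have := mulr_ge0 L0 (sqr_ge0 S); have := mulr_ge0 L0 (sqr_ge0 U); nra.
Qed.

Definition evalc (w : R[i]) (f : {poly R}) : R[i] := (map_poly (real_complex R) f).[w].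

Lemma evalcD w f g : evalc w (f + g) = evalc w f + evalc w g.
Proof. by rewrite /evalc rmorphD hornerD. Qed.

Lemma evalcM w f g : evalc w (f * g) = evalc w f * evalc w g.
Proof. by rewrite /evalc rmorphM hornerM. Qed.

Lemma evalcZ w c f : evalc w (c *: f) = c%:C%C * evalc w f.
Proof. by rewrite /evalc map_polyZ hornerZ. Qed.

Lemma sqr_normcE (z : R[i]) : Normc.normc z ^+ 2 = complex.Re z ^+ 2 + complex.Im z ^+ 2.
Proof. by case: z => a b /=; rewrite sqr_sqrtr // addr_ge0 ?sqr_ge0. Qed.

Lemma normc_real (c : R) : Normc.normc c%:C%C = `|c|.
Proof. by rewrite /= expr0n addr0 sqrtr_sqr. Qed.

Section UnitCircle.
Context (c s : R) (cs1 : c ^+ 2 + s ^+ 2 = 1).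
Let w : R[i] := (c +i* s)%C.
Let tau := 2 * eps * (1 - c).

(** Applied to both [B] and [bernc], where a b = p0 p1, it yields [1 - tau]; and p0 p1 |1 - w|^2 is
    [tau] as well. A single parameter thus governs all entries of the step. *)
Lemma sqr_normc_affine (a b : R) : a + b = 1 ->
  Normc.normc (evalc w (a%:P + b *: 'X)) ^+ 2 = 1 - 2 * (a * b) * (1 - c).
Proof.
move=> ab1; rewrite evalcD evalcZ /evalc map_polyC map_polyX hornerC hornerX sqr_normcE /=.
have bs2 : (b * s) ^+ 2 = b ^+ 2 * (1 - c ^+ 2) by rewrite -cs1; ring.
by have -> : a = 1 - b; [rewrite -ab1 addrK | lra].
Qed.

Lemma normc_1X2 : Normc.normc (evalc w ((1 - 'X) ^+ 2)) = 2 * (1 - c).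
Proof.
rewrite expr2 evalcM Normc.normcM -expr2 evalcD -scaleN1r evalcZ /evalc.
rewrite rmorph1 map_polyX hornerC hornerX sqr_normcE /=.
by have s2 : s ^+ 2 = 1 - c ^+ 2; [rewrite -cs1; ring | lra].
Qed.

Lemma energy_decay l n : admissible p0 p1 l ->
  Normc.normc (evalc w (sum_gf (nseq n l))) ^+ 2 +
    `|l| * tau * Normc.normc (evalc w (gap_gf (nseq n l))) ^+ 2 <=
  (1 - 4 / 5 * tau) ^+ n.+1.
Proof.
move=> adml; have e0 : 0 < eps by exact: eps_gt0.
have c1 : -1 <= c <= 1.
  rewrite -ler_norml -(@ler_sqr _ `|c| 1) ?nnegrE // real_normK ?num_real //.
  by rewrite expr1n -cs1 lerDl sqr_ge0.
have tau01 : 0 <= tau <= 1.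
  have := eps_le p01; case/andP: c1 => c1 c2 e4; rewrite /tau; apply/andP; split.
    by rewrite !mulr_ge0 ?(ltW p0_gt0) ?(ltW p1_gt0) //; lra.
  by have := ler_wpM2l (ltW e0) c1; lra.
have L01 : 0 <= `|l| <= 1 / 100 by rewrite normr_ge0; case/andP: adml.
set a := Normc.normc (evalc w B).
have a0 : 0 <= a by rewrite /a; case: (evalc _ _) => ? ?; exact: sqrtr_ge0.
have nc0 (z : R[i]) : 0 <= Normc.normc z by case: z => ? ?; exact: sqrtr_ge0.
have aE : a ^+ 2 = 1 - tau by rewrite /a sqr_normc_affine.
have aE' : Normc.normc (evalc w (bernc p0 p1)) = a.
  have aE2 : Normc.normc (evalc w (bernc p0 p1)) ^+ 2 = 1 - tau.
    rewrite /bernc sqr_normc_affine; last by rewrite addrC.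
    by rewrite /tau [p1 * p0]mulrC.
  by apply/eqP; rewrite -(@eqrXn2 _ 2) ?nc0 // aE2 aE.
elim: n => [|n IHn].
  rewrite /sum_gf /gap_gf /= -/a aE expr1.
  have -> : Normc.normc (evalc w 1) = 1 by rewrite /evalc rmorph1 hornerC Normc.normc1.
  by case/andP: tau01 => t0 _; have := ler_wpM2r t0 (andP L01).2; rewrite expr1n; lra.
have -> : nseq n.+1 l = l :: nseq n l by [].
rewrite exprS; apply: le_trans (ler_wpM2l _ IHn); last by case/andP: tau01; lra.
apply: (@energy_step tau `|l| a) => //; rewrite ?nc0 //=.
  rewrite sum_gf_cons evalcD evalcM evalcZ evalcM.
  apply: (le_trans (le_normcD _ _)); rewrite !Normc.normcM normc_real normc_1X2 -/a lerD2l.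
  by rewrite normrM (gtr0_norm e0) /tau le_eqVlt; apply/orP; left; apply/eqP; ring.
rewrite gap_gf_cons evalcD evalcZ evalcM.
by apply: (le_trans (le_normcD _ _)); rewrite !Normc.normcM normc_real aE' mulrA.
Qed.

End UnitCircle.
End CharacteristicFunction.

(** * A quadratic lower bound for 1 - cos *)

Section CosineBound.
Context {R : realType}.
Implicit Types x theta : R.

Lemma sin_le x : 0 <= x -> sin x <= x.
Proof.
move=> x0; have [z _] := @MVT_segment R sin cos 0 x x0 (fun _ _ => is_derive_sin _)
  (continuous_subspaceT (@continuous_sin R)).
by rewrite sin0 !subr0 => ->; rewrite -[leRHS]mul1r ler_wpM2r ?cos_le1.
Qed.

Lemma cos_half_angle x : cos x = 1 - 2 * sin (x / 2) ^+ 2.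
Proof.
have {1}-> : x = (x / 2) *+ 2 by rewrite -mulr_natr divfK ?pnatr_eq0.
by rewrite cos_mulr2n; have := cos2Dsin2 (x / 2); lra.
Qed.

Lemma sin_ge_half x : 0 <= x <= 1 -> x / 2 <= sin x.
Proof.
case/andP=> x0 x1; have [z] := @MVT_segment R sin cos 0 x x0 (fun _ _ => is_derive_sin _)
  (continuous_subspaceT (@continuous_sin R)).
rewrite in_itv /= => /andP[z0 zx]; rewrite sin0 !subr0 => ->.
rewrite mulrC ler_wpM2r // cos_half_angle.
have z2 : 0 <= z / 2 by lra.
have s0 : 0 <= sin (z / 2).
  by apply: sin_ge0_pi; have := @pi_ge2 R; move=> ?; apply/andP; split; lra.
by have := sin_le z2; nra.
Qed.

(** Up to pi / 2, the half-angle formula and sin(x / 2) >= x / 4 give even x^2 / 8. Beyond, the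
    cosine is nonpositive and x <= 4 suffices. *)
Lemma cos_le_quadratic theta : - pi <= theta <= pi -> theta ^+ 2 / 16 <= 1 - cos theta.
Proof.
move=> th; rewrite -(cos_norm theta) -[theta ^+ 2]real_normK ?num_real //.
have : `|theta| <= pi by rewrite ler_norml.
move: `|theta| (normr_ge0 theta) => {th}x x0 xpi.
have pi4 := @pihalf_lt2 R.
have [lex|gtx] := leP x (pi / 2).
  rewrite cos_half_angle; have := @sin_ge_half (x / 2).
  have -> : 0 <= x / 2 <= 1 by apply/andP; split; lra.
  by move=> /(_ isT) h; have : 0 <= x / 2 / 2; [lra | nra].
rewrite -[x in cos x](subrK (pi / 2)) cosDpihalf.
have : 0 <= sin (x - pi / 2).
  by apply: sin_ge0_pi; have := @pi_ge2 R; move=> ?; apply/andP; split; lra.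
by move=> ?; have : x <= 4; [lra | nra].
Qed.

End CosineBound.

Section CharacteristicBound.
Context {R : realType} (p0 p1 : R).
Context (p0_gt0 : 0 < p0) (p1_gt0 : 0 < p1) (p01 : p0 + p1 = 1).

(** The energy controls the squared modulus with rate (4/5) 2 / 16 = 1/10; taking the square root
    gives 1/20. *)
Lemma characteristic_bound l n (theta : R) : admissible p0 p1 l -> - pi <= theta <= pi ->
  Normc.normc (evalc (cos (- theta) +i* sin (- theta))%C (sum_gf p0 p1 (nseq n l))) <=
  expR (- (p0 * p1 * n.+1%:R * theta ^+ 2) / 20).
Proof.
move=> adml th; have cs1 := cos2Dsin2 (- theta); rewrite cosN in cs1 *.
have e0 : 0 < p0 * p1 by exact: eps_gt0.
rewrite -ler_sqr ?nnegrE ?expR_ge0 //; last by case: (evalc _ _) => ? ?; exact: sqrtr_ge0.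
have := energy_decay p0_gt0 p1_gt0 p01 cs1 n adml.
set tau := 2 * (p0 * p1) * (1 - cos theta) => le_s.
have cb := cos_le_quadratic th.
have tau0 : 0 <= tau.
  by rewrite mulr_ge0 ?mulr_ge0 ?(ltW p0_gt0) ?(ltW p1_gt0) // subr_ge0 cos_le1.
have tau1 : tau <= 1.
  by have := eps_le p01; have := cos_geN1 theta; rewrite /tau; nra.
apply: (@le_trans _ _ ((1 - 4 / 5 * tau) ^+ n.+1)).
  by apply: le_trans le_s; rewrite lerDl; apply: mulr_ge0 (sqr_ge0 _); exact: mulr_ge0.
apply: (@le_trans _ _ (expR (- (4 / 5 * tau)) ^+ n.+1)).
  by rewrite lerXn2r ?nnegrE ?expR_ge0 //; [lra | exact: expR_ge1Dx].
rewrite -!expRM_natl ler_expR.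
have := ler_wpM2l (ltW (mulr_gt0 e0 (ltr0Sn R n))) cb.
by rewrite /tau; lra.
Qed.

End CharacteristicBound.

(** * Tail comparison by exponential tilting *)

Section ExponentialTilt.
Context {R : realType}.
Implicit Types s v : R.

Lemma expR_le_inv v : v < 1 -> expR v <= (1 - v)^-1.
Proof.
move=> v1; have -> : expR v = (expR (- v))^-1 by rewrite expRN invrK.
by rewrite lef_pV2 ?posrE ?expR_gt0 ?subr_gt0 //; exact: expR_ge1Dx.
Qed.

Lemma expR_le_quadratic v : v <= 1 / 2 -> expR v <= 1 + v + 2 * v ^+ 2.
Proof.
move=> v2; have v1 : 0 < 1 - v by lra.
apply: (le_trans (expR_le_inv _)); first by lra.
by rewrite -[leLHS]mul1r ler_pdivrMr //; have := sqr_ge0 v; nra.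
Qed.

Lemma expR_bnd s : - (1 / 6) <= s <= 1 / 6 -> 5 / 6 <= expR s <= 6 / 5.
Proof.
case/andP=> s1 s2; apply/andP; split; first by have := expR_ge1Dx s; lra.
apply: (le_trans (expR_le_inv _)); first by lra.
by rewrite -[leLHS]mul1r ler_pdivrMr; lra.
Qed.

Lemma sqr_1BexpR s : - (1 / 6) <= s <= 1 / 6 -> (1 - expR s) ^+ 2 <= 36 / 25 * s ^+ 2.
Proof.
case/andP=> s1 s2; have h1 := expR_ge1Dx s.
have [s0|s0] := leP 0 s.
  have h2 : expR s - 1 <= 6 / 5 * s.
    have := @expR_le_inv s; have -> : s < 1 by lra.
    move=> /(_ isT); rewrite -[(1 - s)^-1]mul1r ler_pdivlMr; last by lra.
    by nra.
  by nra.
have h2 : expR s <= 1 by rewrite -[leRHS]expR0 ler_expR ltW.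
by nra.
Qed.

Context (p0 p1 : R).

Lemma size_chain ls :
  (size (sum_gf p0 p1 ls) <= (size ls).+2)%N /\ (size (gap_gf p0 p1 ls) <= (size ls).+1)%N.
Proof.
have size_affine (a b : R) : (size (a%:P + b *: 'X : {poly R})%R <= 2)%N.
  rewrite (leq_trans (size_polyD _ _)) // geq_max (leq_trans (size_polyC_leq1 _)) //=.
  by rewrite (leq_trans (size_scale_leq _ _)) ?size_polyX.
have size_mul (f g : {poly R}) m k : (size f <= m.+1)%N -> (size g <= k)%N ->
    (size (f * g)%R <= m + k)%N.
  by move=> lef leg; rewrite (leq_trans (size_polyMleq _ _)) //; lia.
have size_1X2 : (size ((1 - 'X) ^+ 2 : {poly R})%R <= 3)%N.
  have s1 : (size (1 - 'X : {poly R})%R <= 2)%N.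
    by have := size_affine 1 (-1); rewrite scaleN1r polyC1.
  by rewrite expr2; exact: (size_mul _ _ 1%N 2%N s1 s1).
elim: ls => [|l ls [IHs IHu]].
  by split; [exact: size_affine | rewrite size_poly1].
rewrite sum_gf_cons gap_gf_cons; split; rewrite (leq_trans (size_polyD _ _)) // geq_max /=.
  apply/andP; split; first exact: (size_mul _ _ 1%N _ (size_affine _ _) IHs).
  by rewrite (leq_trans (size_scale_leq _ _)) //; exact: (size_mul _ _ 2%N _ size_1X2 IHu).
apply/andP; split; first by [].
rewrite (leq_trans (size_scale_leq _ _)) //.
exact: (size_mul _ _ 1%N _ (size_affine _ _) IHu).
Qed.

Context (p0_gt0 : 0 < p0) (p1_gt0 : 0 < p1) (p01 : p0 + p1 = 1).

Local Notation B := (bern p0 p1).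

(** Centering cancels the linear terms of the two quadratic bounds, and the rest is 2 p0 p1 s^2 <=
    s^2 / 2. *)
Lemma bern_centered_mgf s : - (1 / 6) <= s <= 1 / 6 ->
  B.[expR s] * expR (- (p1 * s)) <= expR (s ^+ 2 / 2).
Proof.
case/andP=> s1 s2; rewrite horner_bern mulrDl -mulrA -expRD.
have p1_lt1 : p1 < 1 by rewrite -p01 ltrDr.
have p0_lt1 : p0 < 1 by rewrite -p01 ltrDl.
have p0E : p0 = 1 - p1 by rewrite -p01 addrK.
have -> : s - p1 * s = p0 * s by rewrite p0E; ring.
have q1 : expR (- (p1 * s)) <= 1 + - (p1 * s) + 2 * (- (p1 * s)) ^+ 2.
  by apply: expR_le_quadratic; have := ler_wpM2l (ltW p1_gt0) s1; lra.
have q0 : expR (p0 * s) <= 1 + p0 * s + 2 * (p0 * s) ^+ 2.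
  by apply: expR_le_quadratic; have := ler_wpM2l (ltW p0_gt0) s2; lra.
apply: le_trans (lerD (ler_wpM2l (ltW p0_gt0) q1) (ler_wpM2l (ltW p1_gt0) q0)) _.
apply: le_trans (expR_ge1Dx _).
have -> : p0 * (1 + - (p1 * s) + 2 * (- (p1 * s)) ^+ 2) +
    p1 * (1 + p0 * s + 2 * (p0 * s) ^+ 2) = (p0 + p1) * (1 + 2 * (p0 * p1) * s ^+ 2).
  by rewrite p0E; ring.
rewrite p01 mul1r lerD2l; have := eps_le p01; have := sqr_ge0 s => u v.
by have := ler_wpM2r u v; lra.
Qed.

(** [beta] exceeds [B.[y]] by so little that the rate 1/2 grows only to 51/100; absorbing the factor
    linear in the length costs another 1/100, for 13/25 in all. One missing power of [beta] costs
    6/5, and 390 y <= 468, so that 562 bounds (6/5) 468. *)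
Lemma tilted_difference l n s : admissible p0 p1 l -> - (1 / 6) <= s <= 1 / 6 ->
  expR (- (p1 * s * n.+1%:R)) *
    wnorm (expR s) (sum_gf p0 p1 (nseq n l) - B ^+ n.+1) <=
  562 * `|l| * expR (13 / 25 * s ^+ 2 * n.+1%:R).
Proof.
move=> adml s6; have y_bnd := expR_bnd s6; have x2 := sqr_1BexpR s6.
set y := expR s in y_bnd x2 *; set t := n.+1%:R.
have s0 := sqr_ge0 s; have t0 : 0 < t by rewrite /t ltr0n.
have x0 := sqr_ge0 (1 - y); have /andP[b1 b2] := horner_bern_bnd p0_gt0 p1_gt0 p01 y_bnd.
have le_norm := wnorm_sum_gf_sub_binomial p0_gt0 p1_gt0 p01 y_bnd n adml.
apply: (le_trans (ler_wpM2l (expR_ge0 _) le_norm)).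
set beta := B.[y] + _; set e := expR (- _).
have beta1 : 5 / 6 <= beta by rewrite /beta; lra.
have beta0 : 0 <= beta by lra.
have beta_tilt : beta * expR (- (p1 * s)) <= expR (51 / 100 * s ^+ 2).
  have le_beta : beta <= B.[y] * expR (1 / 100 * s ^+ 2).
    have := ler_wpM2l (_ : 0 <= B.[y]) (expR_ge1Dx (1 / 100 * s ^+ 2)).
    by move=> /(_ ltac:(lra)); have := ler_wpM2r s0 b1; rewrite /beta; lra.
  apply: (le_trans (ler_wpM2r (expR_ge0 _) le_beta)).
  rewrite mulrAC; apply: (le_trans (ler_wpM2r (expR_ge0 _) (bern_centered_mgf s6))).
  by rewrite -expRD ler_expR; lra.
have tilt : e * beta ^+ n <= 6 / 5 * expR (51 / 100 * s ^+ 2 * t).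
  have -> : e = expR (- (p1 * s)) ^+ n.+1.
    by rewrite -expRM_natl /e /t; congr expR; ring.
  have := lerXn2r n.+1 _ _ beta_tilt; rewrite !nnegrE mulr_ge0 ?expR_ge0 // => /(_ isT isT).
  have -> : expR (51 / 100 * s ^+ 2) ^+ n.+1 = expR (51 / 100 * s ^+ 2 * t).
    by rewrite -expRM_natl mulrC.
  rewrite exprMn exprS.
  set E := expR (- (p1 * s)) ^+ n.+1; have E0 : 0 <= E by rewrite exprn_ge0 ?expR_ge0.
  have := ler_wpM2r (mulr_ge0 E0 (exprn_ge0 n beta0)) beta1.
  by lra.
have lin : 390 * y + 13 / 40 * (1 - y) ^+ 2 * t <= 468 * expR (1 / 100 * s ^+ 2 * t).
  have := expR_ge1Dx (1 / 100 * s ^+ 2 * t); have := ler_wpM2r (ltW t0) x2.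
  by case/andP: y_bnd => _ y2; have := mulr_ge0 s0 (ltW t0); lra.
have lin0 : 0 <= 390 * y + 13 / 40 * (1 - y) ^+ 2 * t.
  by have := mulr_ge0 x0 (ltW t0); case/andP: y_bnd => y1 _; lra.
have -> : 13 / 25 * s ^+ 2 * t = 51 / 100 * s ^+ 2 * t + 1 / 100 * s ^+ 2 * t by field.
rewrite expRD.
have -> : forall z, e * (`|l| * (beta ^+ n * z)) = `|l| * ((e * beta ^+ n) * z).
  by move=> z; ring.
rewrite [562 * _]mulrC -[leRHS]mulrA; apply: ler_wpM2l => //.
have eb0 : 0 <= e * beta ^+ n by rewrite mulr_ge0 ?expR_ge0 ?exprn_ge0.
apply: (le_trans (ler_pM eb0 lin0 tilt lin)).
have := mulr_ge0 (expR_ge0 (51 / 100 * s ^+ 2 * t)) (expR_ge0 (1 / 100 * s ^+ 2 * t)).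
by lra.
Qed.

Lemma tail_difference l n (a : R) M : admissible p0 p1 l -> 0 <= a ->
  \sum_(k < M | a <= `|k%:R - p1 * n.+1%:R|)
     `|(sum_gf p0 p1 (nseq n l) - B ^+ n.+1)`_k| <=
  1124 * `|l| * expR (- a ^+ 2 / (8 * n.+1%:R)).
Proof.
move=> adml a0; set t := n.+1%:R; set f := _ - _.
have t0 : 0 < t by rewrite /t ltr0n.
have p1_lt1 : p1 < 1 by rewrite -p01 ltrDr.
have size_f : (size f <= n.+2)%N.
  rewrite (leq_trans (size_polyD _ _)) // geq_max size_polyN.
  have [+ _] := size_chain (nseq n l); rewrite size_nseq => -> /=.
  have [+ _] := size_chain (nseq n 0); rewrite size_nseq.
  have -> // : sum_gf p0 p1 (nseq n 0) = B ^+ n.+1.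
  by elim: (n) => [|m IHm] //; rewrite [nseq _ _]/= sum_gf_cons mul0r scale0r addr0 IHm -exprS.
(* For a > t the sum vanishes: the coefficients live on 0 <= k <= t, where |k - p1 t| <= t. *)
have [le_at|lt_ta] := leP a t; last first.
  rewrite big1; first by apply: mulr_ge0 (expR_ge0 _); apply: mulr_ge0 (normr_ge0 _); exact: ler0n.
  move=> k le_ak; apply/eqP; rewrite normr_eq0.
  have [lt_k|le_k] := ltnP k n.+2; last by rewrite nth_default // (leq_trans size_f).
  have k_le : k%:R <= t by rewrite /t ler_nat.
  have k_ge := ler0n R k; have := mulr_gt0 p1_gt0 t0.
  have : p1 * t < t by rewrite -[ltRHS]mul1r ltr_pM2r.
  move: le_ak; rewrite -/t ler_normr => /orP[]; lra.
(* This choice keeps exp(s) and exp(- s) within [5/6, 6/5], and the exponent (13/900 - 1/6) a^2 / t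
   it leads to is still below - a^2 / (8 t). *)
pose s := a / (6 * t).
have t6 : 0 < 6 * t by rewrite mulr_gt0.
have s0 : 0 <= s by rewrite divr_ge0 // ltW.
have s6 : s <= 1 / 6 by rewrite ler_pdivrMr // mulrA; lra.
have bnd1 : - (1 / 6) <= s <= 1 / 6 by apply/andP; split; lra.
have bnd2 : - (1 / 6) <= - s <= 1 / 6 by apply/andP; split; lra.
pose w r (k : nat) := expR (r * (k%:R - p1 * t)).
have tilt r : \sum_(k < M) `|f`_k| * w r k <= expR (- (p1 * r * t)) * wnorm (expR r) f.
  apply: (@le_trans _ _ (\sum_(k < maxn M (size f)) `|f`_k| * w r k)).
    rewrite (big_ord_widen _ (fun k : nat => `|f`_k| * w r k) (leq_maxl M (size f))).
    rewrite [leLHS]big_mkcond; apply: ler_sum => k _; case: ifP => // _.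
    by rewrite mulr_ge0 ?expR_ge0.
  rewrite (wnorm_wide _ (leq_maxr M (size f))) mulr_sumr; apply: ler_sum => k _.
  rewrite -expRM_natl mulrCA ler_wpM2l // -expRD /w le_eqVlt.
  by apply/orP; left; apply/eqP; congr expR; ring.
apply: (@le_trans _ _ (expR (- (s * a)) *
    (\sum_(k < M) `|f`_k| * w s k + \sum_(k < M) `|f`_k| * w (- s) k))).
  rewrite -big_split mulr_sumr [leLHS]big_mkcond; apply: ler_sum => k _ /=.
  case: ifP => [le_ak|_]; last by rewrite mulr_ge0 ?addr_ge0 ?mulr_ge0 ?expR_ge0.
  rewrite -mulrDr mulrCA -[leLHS]mulr1 ler_wpM2l // mulrDr /w -!expRD.
  have e1 := expR_ge0 (- (s * a) + s * (k%:R - p1 * t)).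
  have e2 := expR_ge0 (- (s * a) + - s * (k%:R - p1 * t)).
  move: le_ak; rewrite -/t ler_normr => /orP[] h.
    have : 1 <= expR (- (s * a) + s * (k%:R - p1 * t)).
      by rewrite -[leLHS]expR0 ler_expR; have := ler_wpM2l s0 h; lra.
    by lra.
  have : 1 <= expR (- (s * a) + - s * (k%:R - p1 * t)).
    by rewrite -[leLHS]expR0 ler_expR; have := ler_wpM2l s0 h; lra.
  by lra.
have T1 := le_trans (tilt s) (tilted_difference n adml bnd1).
have T2 := le_trans (tilt (- s)) (tilted_difference n adml bnd2).
rewrite sqrrN in T2.
apply: (le_trans (ler_wpM2l (expR_ge0 _) (lerD T1 T2))).
have -> : expR (- (s * a)) * (562 * `|l| * expR (13 / 25 * s ^+ 2 * n.+1%:R) +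
    562 * `|l| * expR (13 / 25 * s ^+ 2 * n.+1%:R)) =
    1124 * `|l| * (expR (- (s * a)) * expR (13 / 25 * s ^+ 2 * n.+1%:R)) by ring.
apply: ler_wpM2l; first by apply: mulr_ge0 (normr_ge0 _); exact: ler0n.
rewrite -expRD ler_expR -/t.
have q0 : 0 <= a ^+ 2 / t by rewrite divr_ge0 ?sqr_ge0 // ltW.
have -> : - (s * a) + 13 / 25 * s ^+ 2 * t = (13 / 900 - 1 / 6) * (a ^+ 2 / t).
  by rewrite /s; field; rewrite lt0r_neq0.
have -> : - a ^+ 2 / (8 * t) = - (1 / 8) * (a ^+ 2 / t) by field; rewrite lt0r_neq0.
by rewrite ler_wpM2r //; lra.
Qed.

End ExponentialTilt.

(** * Probability laws on the integers given by polynomials *)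

Section PolynomialLaw.
Context {R : realType}.
Implicit Types (f g : {poly R}) (P Q : probability int R).
Local Open Scope classical_set_scope.

Lemma sum_coef_wide f (phi : nat -> R) n : (size f <= n)%N ->
  \sum_(k < size f) f`_k * phi k = \sum_(k < n) f`_k * phi k.
Proof.
move=> le_fn; rewrite (big_ord_widen n (fun k : nat => f`_k * phi k)) // big_mkcond.
apply: eq_bigr => k _; case: ltnP => // le_fk.
by rewrite nth_default // mul0r.
Qed.

Definition is_law P f := forall A : set int,
  P A = (\sum_(k < size f) f`_k * (k%:Z \in A)%:R)%:E.

Definition law_weight f (k : nat) : {nonneg R} := NngNum (normr_ge0 f`_k).

Lemma law_weightE f k : nnegp f -> (law_weight f k)%:num = f`_k.
Proof. by move=> f0; rewrite /law_weight /= ger0_norm. Qed.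

Lemma msum_law f (A : set int) : nnegp f ->
  msum (fun k : nat => mscale (law_weight f k) (\d_(k%:Z))) (size f) A =
  (\sum_(k < size f) f`_k * (k%:Z \in A)%:R)%:E.
Proof.
move=> f0; rewrite /msum -sumEFin; apply: eq_bigr => k _.
transitivity ((law_weight f k)%:num%:E * \d_(k%:Z) A)%E; first by [].
by rewrite law_weightE // diracE -EFinM.
Qed.

Lemma exists_law f : nnegp f -> f.[1] = 1 -> exists P, is_law P f.
Proof.
move=> f0 f1.
pose mu : {measure set int -> \bar R} :=
  msum (fun k : nat => mscale (law_weight f k) (\d_(k%:Z))) (size f).
have muT : mu setT = 1%E.
  rewrite /mu /= msum_law //; congr (_%:E).
  rewrite -[RHS]f1 horner_coef; apply: eq_bigr => k _.
  by rewrite mem_set // expr1n.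
pose H := @Measure_isProbability.Build _ _ R mu muT.
pose P : probability int R := HB.pack
  (msum (fun k : nat => mscale (law_weight f k) (\d_(k%:Z))) (size f)) H.
by exists P => A; exact: msum_law.
Qed.

Lemma integral_law P f (h : int -> R) : is_law P f -> nnegp f ->
  (\int[P]_x (h x)%:E)%E = (\sum_(k < size f) f`_k * h k%:Z)%:E.
Proof.
move=> Pf f0.
pose mu : {measure set int -> \bar R} :=
  msum (fun k : nat => mscale (law_weight f k) (\d_(k%:Z))) (size f).
have Pmu : (\int[P]_x (h x)%:E)%E = (\int[mu]_x (h x)%:E)%E.
  by apply: eq_measure_integral => A _ _; exact: etrans (Pf A) (esym (msum_law A f0)).
have ge0_int (g : int -> R) : (forall x, 0 <= g x) ->
    (\int[mu]_x (g x)%:E)%E = (\sum_(k < size f) f`_k * g k%:Z)%:E.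
  move=> g0; rewrite /mu ge0_integral_measure_sum //=; last by move=> x _; rewrite lee_fin.
  rewrite -sumEFin; apply: eq_bigr => k _.
  rewrite ge0_integral_mscale //=; last by move=> x _; rewrite lee_fin.
  by rewrite integral_dirac //= diracT mul1e law_weightE // -EFinM.
(* The Dirac decomposition is applied to the positive and negative parts of [h]; both integrals are
   finite sums, so their difference is harmless. *)
rewrite Pmu integralE.
have hp : (fun x => (h x)%:E)^\+%E = (fun x => (Num.max (h x) 0)%:E).
  by apply/funext => x; rewrite funeposE -EFin_max.
have hn : (fun x => (h x)%:E)^\-%E = (fun x => (Num.max (- h x) 0)%:E).
  by apply/funext => x; rewrite funenegE -EFinN -EFin_max.
rewrite hp hn !ge0_int; try by move=> x; rewrite le_max lexx orbT.
rewrite -EFinB -sumrB; congr (_%:E); apply: eq_bigr => k _.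
rewrite -mulrBr; congr (_ * _).
have [h0|] := boolP (0 <= h k%:Z); last rewrite -ltNge => h0.
  by rewrite (max_l h0) max_r ?oppr_le0 // subr0.
by rewrite (max_r (ltW h0)) max_l ?oppr_ge0 ?(ltW h0) // sub0r opprK.
Qed.

Lemma expectation_law P f (h : int -> R) : is_law P f -> nnegp f ->
  ('E_P[h] = (\sum_(k < size f) f`_k * h k%:Z)%:E)%E.
Proof. by move=> Pf f0; rewrite unlock; exact: integral_law. Qed.

Lemma law_set1 P f (k : nat) : is_law P f -> P [set k%:Z] = (f`_k)%:E.
Proof.
move=> ->; congr (_%:E).
have [lt_k|le_k] := ltnP k (size f); last first.
  rewrite nth_default // big1 // => i _; rewrite memNset ?mulr0 //= => -[ik].
  by have := ltn_ord i; rewrite ik ltnNge le_k.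
rewrite (bigD1 (Ordinal lt_k)) //= mem_set // mulr1 big1 ?addr0 // => i ne_ik.
rewrite memNset ?mulr0 //= => -[ik]; case/eqP: ne_ik; exact: val_inj.
Qed.

Lemma law_set1_neg P f (n : nat) : is_law P f -> P [set Negz n] = 0%E.
Proof. by move=> ->; rewrite big1 // => i _; rewrite memNset ?mulr0. Qed.

Lemma convolution_law P Q f g : is_law P f -> is_law Q g -> nnegp f ->
  is_law (convolution P Q) (f * g).
Proof.
move=> Pf Qg f0 A; rewrite /convolution /distribution /pushforward /=.
rewrite /product_measure1 /=.
have -> : (fun x : int => Q (xsection (addz_pair @^-1` A) x)) =
    (fun x => (\sum_(k < size g) g`_k * (x + k%:Z \in A)%:R)%:E).
  apply/funext => x; rewrite Qg; congr (_%:E); apply: eq_bigr => k _; congr (_ * _%:R).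
  by congr nat_of_bool; apply/idP/idP; rewrite /xsection /= !inE /= ?inE.
rewrite (integral_law _ Pf f0); congr (_%:E).
pose phi (k : nat) : R := (k%:Z \in A)%:R.
rewrite -[RHS]/(\sum_(k < size (f * g)) (f * g)`_k * phi k).
rewrite (sum_coef_wide phi (n := (size f + size g)%N)); last first.
  by rewrite (leq_trans (size_polyMleq _ _)) // leq_pred.
have shift (i : nat) (u : {poly R}) n : (size u + i <= n)%N ->
    \sum_(k < n) ('X^i * u)`_k * phi k = \sum_(k < size u) u`_k * phi (i + k)%N.
  move=> le_n; rewrite -(subnKC (leq_trans (leq_addl _ _) le_n)) big_split_ord /=.
  rewrite big1 ?add0r => [|k _]; last by rewrite coefXnM ltn_ord mul0r.
  have le_u : (size u <= n - i)%N by rewrite leq_subRL ?(leq_trans (leq_addl _ _) le_n) // addnC.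
  rewrite (sum_coef_wide (fun k => phi (i + k)%N) le_u).
  by apply: eq_bigr => k _; rewrite coefXnM ltnNge leq_addr /= addKn.
have fgE : f * g = \sum_(i < size f) f`_i *: 'X^i * g.
  by rewrite -{1}[f]coefK poly_def mulr_suml.
transitivity (\sum_(i < size f) f`_i * \sum_(k < size f + size g) ('X^i * g)`_k * phi k).
  apply: eq_bigr => i _; congr (_ * _); rewrite shift; last first.
    by rewrite addnC leq_add2r ltnW.
  by apply: eq_bigr => k _; rewrite /phi PoszD.
transitivity (\sum_(i < size f) \sum_(k < size f + size g) (f`_i *: 'X^i * g)`_k * phi k).
  apply: eq_bigr => i _; rewrite mulr_sumr; apply: eq_bigr => k _.
  by rewrite -scalerAl coefZ mulrA.
rewrite exchange_big; apply: eq_bigr => k _ /=.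
by rewrite -mulr_suml fgE coef_sum.
Qed.

Lemma indep_sum_law l (P : 'I_l -> probability int R) (f : 'I_l -> {poly R}) :
  (forall i, is_law (P i) (f i)) -> (forall i, nnegp (f i)) ->
  is_law (indep_sum P) (\prod_(i < l) f i).
Proof.
move=> Pf f0; rewrite /indep_sum; elim/big_rec2: _ => [|i g Q _ Qg].
  move=> A /=; rewrite size_poly1 big_ord_recl big_ord0 addr0 coef1 mul1r.
  by rewrite /dirac /= indicE.
exact: convolution_law.
Qed.

Lemma esum_law (D : set int) (a : int -> \bar R) (u : nat -> R) M :
  (forall k : nat, a k%:Z = (u k)%:E) -> (forall n : nat, a (Negz n) = 0%E) ->
  (forall k, 0 <= u k) -> (forall k, (M <= k)%N -> u k = 0) ->
  (\esum_(j in D) a j)%E = (\sum_(k < M | k%:Z \in D) u k)%:E.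
Proof.
move=> ak an u0 uM.
have a0 j : (0 <= a j)%E by case: j => k; rewrite ?ak ?an // lee_fin.
rewrite (esumID (Posz @` `I_M)) // [X in (_ + X)%E]esum1 ?adde0; last first.
  case=> [k|n] [_ /= nk]; last by rewrite an.
  rewrite ak uM // leqNgt; apply/negP => lt_k; apply: nk; exists k => //.
rewrite esum_mkcondl esum_image; last by move=> i j _ _ [].
rewrite esum_fset //; last first.
  by move=> i _; case: ifP => // _; rewrite ak lee_fin.
rewrite -fsbig_ord /= [in RHS]big_mkcond -sumEFin; apply: eq_bigr => k _ /=.
by case: ifP => // _; rewrite ak.
Qed.

End PolynomialLaw.

(** * Lumping the walk on V to the two-state chain *)

Section StickyWalkLaw.
Context {R : realType} {V : finType} (V0 V1 : {set V}).
Context (hdisj : [disjoint V0 & V1]) (hcover : V0 :|: V1 = [set: V]).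
Context (hV0 : V0 != finset.set0) (hV1 : V1 != finset.set0).
Context (val : V -> int).
Context (hval0 : forall v, v \in V0 -> val v = 0) (hval1 : forall v, v \in V1 -> val v = 1).
Context (p0 p1 : R) (hp0 : p0 = #|V0|%:R / #|V|%:R) (hp1 : p1 = #|V1|%:R / #|V|%:R).
Context (lambda : R).

Local Notation G := (sticky_walk V0 V1 p0 p1 lambda).
Let side (v : V) : bool := v \in V1.
Let block (b : bool) : {set V} := if b then V1 else V0.

Lemma in_V0 v : (v \in V0) = ~~ side v.
Proof.
have := finset.in_setT v; rewrite -hcover finset.in_setU /side => /orP[h|h].
  by rewrite h (disjointFr hdisj h).
by rewrite h (disjointFl hdisj h).
Qed.

Lemma block_gt0 b : 0 < #|block b|%:R :> R.
Proof. by rewrite ltr0n card_gt0; case: b. Qed.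

Lemma card_blocks : (#|V0| + #|V1|)%N = #|V|.
Proof. by rewrite -cardsT -hcover cardsU disjoint_setI0 // cards0 subn0. Qed.

Lemma card_V_gt0 : 0 < #|V|%:R :> R.
Proof. by rewrite -card_blocks natrD addr_gt0 ?(block_gt0 false) ?(block_gt0 true). Qed.

Lemma p_gt0 : 0 < p0 /\ 0 < p1.
Proof. by rewrite hp0 hp1 !divr_gt0 ?card_V_gt0 ?(block_gt0 false) ?(block_gt0 true). Qed.

Lemma p_sum : p0 + p1 = 1.
Proof. by rewrite hp0 hp1 -mulrDl -natrD card_blocks divff ?lt0r_neq0 ?card_V_gt0. Qed.

Lemma valE v : val v = (side v)%:Z.
Proof.
case sv : (side v); first by rewrite hval1.
by rewrite hval0 // in_V0 sv.
Qed.

Lemma sticky_walkE v' v :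
  G v' v = trans p0 p1 lambda (side v) (side v') / #|block (side v')|%:R.
Proof.
have e0 : p0 = 1 - p1 by rewrite -p_sum addrK.
rewrite /sticky_walk !in_V0 /J_entry /trans.
by case: (side v); case: (side v') => /=; congr (_ / _); rewrite ?e0; ring.
Qed.

(** Lumpability: given the side of its target, a step is uniform on that block. The module is
    generic because the identity serves both for polynomials and, with constant [H], for column
    sums. *)
Lemma sum_block (M : lmodType R) (F : bool -> R) (H : bool -> M) :
  \sum_v (F (side v) / #|block (side v)|%:R) *: H (side v) = \sum_b F b *: H b.
Proof.
rewrite (bigID side) big_bool /=; congr (_ + _).
  rewrite (eq_bigr (fun=> (F true / #|V1|%:R) *: H true)); last by move=> v ->.
  rewrite sumr_const -scaler_nat scalerA mulrCA divff ?mulr1 //.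
  exact: lt0r_neq0 (block_gt0 true).
rewrite (eq_bigr (fun=> (F false / #|V0|%:R) *: H false)); last by move=> v /negPf ->.
rewrite (eq_bigl (mem V0)); last by move=> v; rewrite [RHS]in_V0.
rewrite sumr_const -scaler_nat scalerA mulrCA divff ?mulr1 //.
exact: lt0r_neq0 (block_gt0 false).
Qed.

Definition nsum (s : seq V) : nat := \sum_(v <- s) side v.

Definition walk_gf n (v : V) : {poly R} :=
  \sum_(s : n.-tuple V)
    (\prod_(g <- pairmap (fun v v' => G v' v) v s) g) *: 'X^(nsum (v :: s)).

Lemma big_cons_tuple (M : nmodType) n (F : n.+1.-tuple V -> M) :
  \sum_(w : n.+1.-tuple V) F w = \sum_v \sum_(s : n.-tuple V) F (cons_tuple v s).
Proof.
rewrite pair_big /= (reindex (fun x : V * n.-tuple V => cons_tuple x.1 x.2)) //=.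
exists (fun w => (thead w, behead_tuple w)) => [[v s] _|w _] /=.
  by congr pair; apply: val_inj.
by rewrite [RHS]tuple_eta; apply: val_inj.
Qed.

Lemma walk_gfE n v : walk_gf n v = start_gf p0 p1 (nseq n lambda) (side v).
Proof.
elim: n v => [|n IHn] v.
  rewrite /walk_gf (big_pred1 [tuple]) => [|s]; last exact/esym/eqP/tuple0.
  by rewrite /= big_nil scale1r /nsum big_cons big_nil addn0.
rewrite /walk_gf big_cons_tuple /=.
transitivity ('X^(side v) * \sum_v' G v' v *: walk_gf n v').
  rewrite mulr_sumr; apply: eq_bigr => v' _.
  rewrite /walk_gf scaler_sumr mulr_sumr; apply: eq_bigr => s _.
  rewrite /= big_cons -!scalerAr scalerA; congr (_ *: _).
  by rewrite -exprD; congr ('X^_); rewrite /nsum big_cons.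
congr (_ * _).
rewrite -(sum_block (fun b => trans p0 p1 lambda (side v) b) (start_gf p0 p1 (nseq n lambda))).
by apply: eq_bigr => v' _; rewrite IHn sticky_walkE.
Qed.

Lemma rw_gf n : \sum_(w : n.+1.-tuple V) rw_pmf G w *: 'X^(nsum w) =
  sum_gf p0 p1 (nseq n lambda).
Proof.
rewrite (sum_gfE p_sum) -sum_block big_cons_tuple.
apply: eq_bigr => v _ /=; rewrite -walk_gfE /walk_gf scaler_sumr; apply: eq_bigr => s _.
rewrite scalerA /rw_pmf /=; congr ((_ * _) *: _).
have := card_V_gt0; have := block_gt0 (side v) => b0 v0.
have -> : pr p0 p1 (side v) = #|block (side v)|%:R / #|V|%:R by case: (side v).
by field; rewrite !lt0r_neq0.
Qed.

Lemma sum_val_rw_law n (A : set int) :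
  let f := sum_gf p0 p1 (nseq n lambda) in
  sum_val_rw val G n.+1 A = (\sum_(k < size f) f`_k * (k%:Z \in A)%:R)%:E.
Proof.
rewrite /= -rw_gf /sum_val_rw; congr (_%:E); set f := \sum_(w : _.-tuple V) _.
pose M := maxn (size f) n.+2.
rewrite (sum_coef_wide (fun k : nat => (k%:Z \in A)%:R) (leq_maxl (size f) n.+2)) -/M.
transitivity (\sum_(k < M) \sum_(w : n.+1.-tuple V)
    rw_pmf G w * (k == nsum w :> nat)%:R * (k%:Z \in A)%:R : R); last first.
  apply: eq_bigr => k _; rewrite -mulr_suml /f coef_sum; congr (_ * _).
  by apply: eq_bigr => w _; rewrite coefZ coefXn.
rewrite exchange_big /= big_mkcond /=; apply: eq_bigr => w _.
have lt_w : (nsum w < M)%N.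
  rewrite leq_max; apply/orP; right.
  rewrite ltnS; apply: (@leq_trans (size w)); last by rewrite size_tuple.
  by rewrite /nsum -sum1_size; apply: leq_sum => v _; exact: leq_b1.
rewrite [RHS](bigD1 (Ordinal lt_w)) //= eqxx mulr1 [X in _ + X]big1 ?addr0 => [|k ne_k]; last first.
  have -> : (k == nsum w :> nat) = false; last by rewrite mulr0 mul0r.
  by apply: contraNF ne_k => /eqP kE; apply/eqP/val_inj.
have -> : \sum_(v <- w) val v = (nsum w)%:Z.
  rewrite /nsum; elim: (tval w) => [|v s IHs]; first by rewrite !big_nil.
  by rewrite !big_cons IHs valE PoszD.
by case: (_ \in A); rewrite ?mulr1 ?mulr0.
Qed.

End StickyWalkLaw.

(** * Moments, characteristic function and distances read off coefficients *)

Section LawEvaluation.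
Context {R : realType}.
Implicit Types f : {poly R}.

Lemma coef_eulerian f i : ('X * f^`())`_i = f`_i * i%:R.
Proof. by rewrite coefXM coef_deriv; case: i => [|i] /=; rewrite ?mulr0 // mulr_natr. Qed.

Lemma size_eulerian f : (size ('X * f^`())%R <= size f)%N.
Proof. by apply/leq_sizeP => i le_i; rewrite coef_eulerian nth_default // mul0r. Qed.

Lemma sum_coef1 f : \sum_(k < size f) f`_k = f.[1].
Proof. by rewrite horner_coef; apply: eq_bigr => k _; rewrite expr1n mulr1. Qed.

Lemma sum_coef_natr f : \sum_(k < size f) f`_k * k%:R = f^`().[1].
Proof.
have -> : f^`().[1] = ('X * f^`()).[1] by rewrite hornerM hornerX mul1r.
rewrite (horner_coef_wide _ (size_eulerian f)).
by apply: eq_bigr => k _; rewrite coef_eulerian expr1n mulr1.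
Qed.

Lemma sum_coef_natr_sqr f :
  \sum_(k < size f) f`_k * k%:R ^+ 2 = f^`()^`().[1] + f^`().[1].
Proof.
have -> : f^`()^`().[1] + f^`().[1] = ('X * ('X * f^`())^`()).[1].
  by rewrite derivM derivX hornerM hornerD !hornerM hornerX hornerC !mul1r addrC.
rewrite (horner_coef_wide _ (leq_trans (size_eulerian _) (size_eulerian f))).
by apply: eq_bigr => k _; rewrite !coef_eulerian expr1n mulr1 expr2 mulrA.
Qed.

Lemma Complex_sum n (a b : 'I_n -> R) :
  Complex (\sum_k a k) (\sum_k b k) = \sum_k Complex (a k) (b k).
Proof.
elim: n a b => [|n IHn] a b; first by rewrite !big_ord0.
by rewrite !big_ord_recr /= -IHn.
Qed.

Lemma char_fun_law (P : probability int R) f (theta : R) : is_law P f -> nnegp f ->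
  char_fun P theta = evalc (cos (- theta) +i* sin (- theta))%C f.
Proof.
move=> Pf f0; rewrite /char_fun !(expectation_law _ Pf f0) /= Complex_sum.
have demoivre (k : nat) : (cos (- theta) +i* sin (- theta))%C ^+ k =
    (cos (- theta * k%:R) +i* sin (- theta * k%:R))%C.
  elim: k => [|k IHk]; first by rewrite expr0 mulr0 cos0 sin0.
  rewrite exprSr IHk -natr1 mulrDr mulr1 cosD sinD.
  by apply/eqP; rewrite eq_complex /= eqxx addrC eqxx.
rewrite /evalc horner_coef size_map_poly; apply: eq_bigr => k _.
rewrite coef_map demoivre; apply/eqP; rewrite eq_complex /=.
by rewrite !mul0r subr0 addr0 !eqxx.
Qed.

Lemma coef_bern_exp (p0 p1 : R) t k :
  (bern p0 p1 ^+ t)`_k = p0 ^+ (t - k) * p1 ^+ k *+ 'C(t, k).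
Proof.
rewrite /bern exprDn coef_sum.
have term (i : nat) : ((p0%:P ^+ (t - i) * (p1 *: 'X) ^+ i *+ 'C(t, i) : {poly R}))`_k =
    p0 ^+ (t - i) * p1 ^+ i *+ 'C(t, i) * (k == i)%:R.
  rewrite coefMn -polyC_exp coefCM exprZn coefZ coefXn mulrA.
  by rewrite [RHS]mulrnAl.
under eq_bigr do rewrite term.
have [le_kt|lt_tk] := leqP k t.
  rewrite (bigD1 (inord k)) //= inordK // eqxx mulr1 big1 ?addr0 // => i.
  move=> ne_i; have -> : (k == i) = false; last by rewrite mulr0.
  by apply: contraNF ne_i => /eqP ->; rewrite inord_val.
rewrite bin_small // mulr0n big1 // => i _.
have -> : (k == i) = false; last by rewrite mulr0.
by apply/eqP => kE; have := ltn_ord i; rewrite -kE ltnS leqNgt lt_tk.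
Qed.

Lemma binomialZ_set1 (p0 p1 : R) t (k : nat) : 0 <= p1 <= 1 -> p0 + p1 = 1 ->
  binomialZ t p1 [set k%:Z]%classic = ((bern p0 p1 ^+ t)`_k)%:E.
Proof.
move=> p1_01 p01; rewrite /binomialZ /pushforward /=.
have -> : (Posz @^-1` [set k%:Z] = [set k])%classic.
  by apply/seteqP; split => [x /= []|x /= ->].
rewrite /binomial_prob p1_01 esum_set1 ?lee_fin ?binomial_pmf_ge0 //.
have p0E : unstable.onem p1 = p0 by rewrite /unstable.onem -p01 addrK.
by rewrite /binomial_pmf coef_bern_exp p0E mulrC.
Qed.

Lemma binomialZ_set1_neg (p1 : R) t n : binomialZ t p1 [set Negz n]%classic = 0%E.
Proof.
rewrite /binomialZ /pushforward /=.
have -> : (Posz @^-1` [set Negz n] = set0)%classic by apply/seteqP; split => x /=.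
exact: measure0.
Qed.

Lemma esum_law_dist (P Q : set int -> \bar R) (f g : {poly R}) (D : set int) M :
  (forall k : nat, P [set k%:Z]%classic = (f`_k)%:E) ->
  (forall n, P [set Negz n]%classic = 0%E) ->
  (forall k : nat, Q [set k%:Z]%classic = (g`_k)%:E) ->
  (forall n, Q [set Negz n]%classic = 0%E) -> (size (f - g)%R <= M)%N ->
  (\esum_(j in D) `|P [set j]%classic - Q [set j]%classic|)%E =
  (\sum_(k < M | k%:Z \in D) `|(f - g)`_k|)%:E.
Proof.
move=> Pf Pn Qg Qn le_M.
apply: (esum_law D (u := fun k => `|(f - g)`_k|)) => [k|n|k|k le_k] //.
- by rewrite Pf Qg coefB.
- by rewrite Pn Qn sube0 abse0.
by rewrite nth_default ?normr0 // (leq_trans le_M).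
Qed.

End LawEvaluation.

(** * Verification of the defining properties *)

Section DiscreteNormalWalk.
Context {R : realType} (p0 p1 sigma2 lambda : R).
Context (p0_gt0 : 0 < p0) (p1_gt0 : 0 < p1) (p01 : p0 + p1 = 1).
Context (adml : admissible p0 p1 lambda) (s2_gt0 : 0 < sigma2).
Context (sigma2E : sigma2 * (1 - lambda) = p0 * p1 * (1 + lambda)).
Context (N : nat -> probability int R).
Context (lawN : forall t, is_law (N t) (sum_gf p0 p1 (nseq t.-1 lambda))).

Local Notation S t := (sum_gf p0 p1 (nseq t.-1 lambda)).

Let lambda_bnd : - (1 / 100) <= lambda <= 1 / 100.
Proof. exact: admissible_norm adml. Qed.

Let adms n : all (admissible p0 p1) (nseq n lambda).
Proof. by rewrite all_nseq adml orbT. Qed.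

Let S_ge0 t : nnegp (S t).
Proof. exact: nnegp_sum_gf. Qed.

Lemma sigma2_sub : sigma2 - p0 * p1 = 2 * lambda / (1 - lambda) * (p0 * p1).
Proof.
have l1 : 1 - lambda != 0 by rewrite lt0r_neq0 //; case/andP: lambda_bnd; lra.
have -> : sigma2 = p0 * p1 * (1 + lambda) / (1 - lambda) by rewrite -sigma2E mulfK.
by field.
Qed.

(** The right side is 2 |lambda| / (1 - lambda), and 2 / (1 - lambda) >= 200/101. This turns costs
    proportional to |lambda| into the form required of the family. *)
Lemma excess_ge : 19 / 10 * `|lambda| <= `|sigma2 / (p0 * p1) - 1|.
Proof.
have e0 : p0 * p1 != 0 by rewrite lt0r_neq0 // mulr_gt0.
have -> : sigma2 / (p0 * p1) - 1 = 2 * lambda / (1 - lambda).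
  by rewrite -[X in _ - X](divff e0) -mulrBl sigma2_sub mulfK.
have l0 : 0 < 1 - lambda by case/andP: lambda_bnd; lra.
have -> : 2 * lambda / (1 - lambda) = lambda * (2 / (1 - lambda)) by ring.
rewrite normrM [leLHS]mulrC; apply: ler_wpM2l => //.
rewrite ger0_norm ?divr_ge0 ?(ltW l0) // ler_pdivlMr //.
by case/andP: lambda_bnd; lra.
Qed.

Lemma walk_mean t : (0 < t)%N -> ('E_(N t)[fun j : int => j%:~R] = (p1 * t%:R)%:E)%E.
Proof.
move=> t0; rewrite (expectation_law _ (lawN t) (S_ge0 t)); congr (_%:E).
transitivity (\sum_(k < size (S t)) (S t)`_k * k%:R); first by [].
by rewrite sum_coef_natr deriv_sum_gf1 // size_nseq prednK.
Qed.

Lemma walk_variance t : (0 < t)%N ->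
  (`| 'V_(N t)[fun j : int => j%:~R] - (sigma2 * t%:R)%:E |
     <= (2 * `|sigma2 - p0 * p1|%R)%:E)%E.
Proof.
move=> t0; rewrite /variance unlock walk_mean // /=.
rewrite (expectation_law _ (lawN t) (S_ge0 t)) -EFinB lee_fin.
set f := S t; set mu := p1 * t%:R.
have -> : \sum_(k < size f) f`_k *
    (((fun j : int => j%:~R) \- cst mu) * ((fun j : int => j%:~R) \- cst mu)) k%:Z =
    f^`()^`().[1] + f^`().[1] - f^`().[1] ^+ 2.
  have muE : f^`().[1] = mu by rewrite deriv_sum_gf1 // size_nseq prednK.
  have f1 : f.[1] = 1 by exact: sum_gf1.
  transitivity (\sum_(k < size f) (f`_k * k%:R ^+ 2 - 2 * mu * (f`_k * k%:R) + mu ^+ 2 * f`_k)).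
    apply: eq_bigr => k _.
    by transitivity (f`_k * ((k%:R - mu) * (k%:R - mu))); [by [] | ring].
  rewrite big_split sumrB -!mulr_sumr /= sum_coef_natr_sqr sum_coef_natr sum_coef1 f1 muE.
  by ring.
have := variance_defect p01 lambda t.-1; rewrite prednK // -/f.
set V := _ - _ ^+ 2; set u := (gap_gf _ _ _).[1] => VE.
have l0 : 0 < 1 - lambda by case/andP: lambda_bnd; lra.
(* The variance defect is exactly the excess times the gap at 1, whose absolute value is at most
   5/4, within c1 = 2. *)
have -> : V - sigma2 * t%:R = - ((sigma2 - p0 * p1) * u).
  apply: (mulfI (lt0r_neq0 l0)); rewrite mulrBr VE sigma2_sub.
  have -> : (1 - lambda) * (sigma2 * t%:R) = p0 * p1 * (1 + lambda) * t%:R.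
    by rewrite -sigma2E; ring.
  by field; rewrite lt0r_neq0.
rewrite normrN normrM mulrC ler_wpM2r //.
have y1 : 5 / 6 <= (1 : R) <= 6 / 5 by apply/andP; split; lra.
apply: (le_trans (horner_le_wnorm _ ler01)).
apply: (le_trans (wnorm_gap_gf p0_gt0 p1_gt0 p01 y1 (adms _))).
by rewrite sum_gf1 //; lra.
Qed.

Lemma walk_bernoulli A : N 1%N A = bernoulliZ p1 A.
Proof.
have p1_01 : 0 <= p1 <= 1 by rewrite (ltW p1_gt0) -p01 lerDr ltW.
rewrite lawN /bernoulliZ /pushforward bernoulli_probE // /sum_gf /=.
rewrite (sum_coef_wide (fun k : nat => (k%:Z \in A)%:R) (n := 2)); last first.
  by have [] := size_chain p0 p1 [::].
rewrite big_ord_recr big_ord1 /= /bern !coefD !coefC !coefZ !coefX /=.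
have p0E : unstable.onem p1 = p0 by rewrite /unstable.onem -p01 addrK.
by rewrite !diracE -!EFinM -EFinD addrC p0E mulr1 mulr0 addr0 add0r.
Qed.

Lemma walk_sum (t l : nat) (ts : 'I_l -> nat) :
  (0 < t)%N -> (0 < l <= t)%N -> (forall i, (0 < ts i)%N) ->
  (\sum_(i < l) ts i = t)%N ->
  (dTV (indep_sum (fun i => N (ts i))) (N t)
     <= (2020 / 2 * ((l%:R - 1) * `|sigma2 / (p0 * p1) - 1|%R / t%:R))%:E)%E.
Proof.
move=> t0 /andP[l0 _] ts0 sum_ts.
pose f := \prod_(i < l) S (ts i).
have lawS : is_law (indep_sum (fun i => N (ts i))) f.
  by apply: indep_sum_law => i; [exact: lawN | exact: S_ge0].
rewrite /dTV (@esum_law_dist _ _ _ f (S t) _ (size (f - S t)%R)) //.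
- rewrite -EFinM lee_fin (eq_bigl xpredT); last by move=> k; rewrite mem_set.
  have -> : \sum_(k < size (f - S t)) `|(f - S t)`_k| = wnorm 1 (f - S t).
    by apply: eq_bigr => k _; rewrite expr1n mulr1.
  pose us := [seq ts i | i <- enum 'I_l].
  have us0 : all (leq 1) us by apply/allP => _ /mapP[i _ ->].
  have sum_us : sumn us = t by rewrite sumnE big_map big_enum.
  have size_us : size us = l by rewrite size_map size_enum_ord.
  have fE : f = \prod_(u <- us) S u by rewrite big_map big_enum.
  move: us us0 sum_us size_us fE => [|u0 us] us0 sum_us size_us fE.
    by rewrite -size_us in l0.
  have := wnorm_prod_sum_gf p0_gt0 p1_gt0 p01 adml us0; rewrite -fE sum_us => le_norm.
  have l1 : l%:R - 1 = (size us)%:R :> R by rewrite -size_us /= -natr1 addrK.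
  rewrite l1; set d := `|sigma2 / _ - 1|.
  have tR : 0 < t%:R^-1 :> R by rewrite invr_gt0 ltr0n.
  have mt0 := mulr_ge0 (ler0n R (size us)) (ltW tR).
  (* 490 is below 1010 times 19/10. *)
  have := ler_wpM2l mt0 excess_ge; have := mulr_ge0 mt0 (normr_ge0 lambda).
  by move: le_norm; rewrite -/d; lra.
- by move=> k; exact: law_set1.
- by move=> n; exact: law_set1_neg lawS.
- by move=> k; exact: law_set1.
- by move=> n; exact: law_set1_neg (lawN t).
Qed.

Lemma walk_tail (t : nat) (a : R) : (0 < t)%N -> 0 <= a ->
  (\esum_(j in [set j : int | (a <= `|j%:~R - p1 * t%:R|)%R]%classic)
      `| N t [set j]%classic - binomialZ t p1 [set j]%classic |
     <= (2020 * `|sigma2 / (p0 * p1) - 1|%R * expR (- a ^+ 2 / (8 * t%:R)))%:E)%E.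
Proof.
move=> t0 a0; have p1_01 : 0 <= p1 <= 1 by rewrite (ltW p1_gt0) -p01 lerDr ltW.
rewrite (@esum_law_dist _ _ _ (S t) (bern p0 p1 ^+ t) _ (size (S t - bern p0 p1 ^+ t)%R)) //.
- rewrite lee_fin.
  have := tail_difference p0_gt0 p1_gt0 p01 t.-1 (size (S t - bern p0 p1 ^+ t)) adml a0.
  rewrite prednK // => le_tail.
  rewrite (eq_bigl (fun k : 'I__ => a <= `|k%:R - p1 * t%:R|)); last first.
    by move=> k; apply/idP/idP; rewrite inE.
  apply: (le_trans le_tail); rewrite ler_wpM2r ?expR_ge0 //.
  (* 1124 is below 2020 times 19/10. *)
  by have := excess_ge; have := normr_ge0 lambda; lra.
- by move=> k; exact: law_set1.
- by move=> n; exact: law_set1_neg (lawN t).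
- by move=> k; exact: binomialZ_set1.
- by move=> n; exact: binomialZ_set1_neg.
Qed.

Lemma walk_char (t : nat) (theta : R) : (0 < t)%N -> - pi <= theta <= pi ->
  `|char_fun (N t) theta|
     <= (expR (- (p0 * p1 * t%:R * theta ^+ 2) / 20))%:C%C.
Proof.
move=> t0 th; rewrite (char_fun_law _ (lawN t) (S_ge0 t)).
have := characteristic_bound p0_gt0 p1_gt0 p01 t.-1 adml th; rewrite prednK //.
by rewrite -lecR; apply: le_trans; rewrite normc_def; case: (evalc _ _).
Qed.

Lemma sticky_discrete_normal_family :
  discrete_normal_family p0 p1 sigma2 2 2020 2020 N.
Proof.
split; first by split; rewrite ?ltr0n.
- exact: walk_mean.
- exact: walk_variance.
- exact: walk_bernoulli.
- exact: walk_sum.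
- exact: walk_tail.
- exact: walk_char.
Qed.

End DiscreteNormalWalk.

Theorem proposition13 (R : realType) (V : finType) (V0 V1 : {set V})
  (hdisj : [disjoint V0 & V1]) (hcover : V0 :|: V1 = [set: V])
  (hV0 : V0 != finset.set0) (hV1 : V1 != finset.set0)
  (val : V -> int)
  (hval0 : forall v, v \in V0 -> val v = 0)
  (hval1 : forall v, v \in V1 -> val v = 1)
  (p0 p1 : R)
  (hp0 : p0 = #|V0|%:R / #|V|%:R) (hp1 : p1 = #|V1|%:R / #|V|%:R)
  (sigma2 : R)
  (hlower : let m := Num.min (Num.min (p0 / p1) (p1 / p0)) (1 / 100) in
            (1 - m) / (1 + m) * (p0 * p1) <= sigma2)
  (hupper : sigma2 <= (1 + 1 / 100) / (1 - 1 / 100) * (p0 * p1))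
  (hpos : 0 < sigma2) :
  let lambda := (sigma2 - p0 * p1) / (sigma2 + p0 * p1) in
  let G := sticky_walk V0 V1 p0 p1 lambda in
  [/\ - Num.min (p0 / p1) (p1 / p0) <= lambda <= 1,
      random_walk_matrix G &
      exists N : nat -> probability int R,
        (forall (t : nat) (A : set int), (0 < t)%N ->
           N t A = sum_val_rw val G t A) /\
        discrete_normal_family p0 p1 sigma2 2 2020 2020 N].
Proof.
move=> lambda G.
have [p0_gt0 p1_gt0] := p_gt0 hdisj hcover hV0 hV1 hp0 hp1.
have p01 := p_sum hdisj hcover hV0 hV1 hp0 hp1.
have e0 : 0 < p0 * p1 by rewrite mulr_gt0.
have s0 : 0 < sigma2 + p0 * p1 by rewrite addr_gt0.
have lambdaE : lambda * (sigma2 + p0 * p1) = sigma2 - p0 * p1.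
  by rewrite /lambda divfK ?lt0r_neq0.
clearbody lambda.
set m := Num.min (Num.min (p0 / p1) (p1 / p0)) (1 / 100) in hlower.
have m_gt0 : 0 < m by rewrite !lt_min !divr_gt0 //; lra.
have [[m_p0 m_p1] m_100] : (m <= p0 / p1 /\ m <= p1 / p0) /\ m <= 1 / 100.
  by rewrite /m !ge_min !lexx ?orbT.
have m_min : m <= Num.min (p0 / p1) (p1 / p0) by rewrite /m ge_min lexx.
(* [lambda] is an increasing function of sigma2, and the two bounds on sigma2 are the preimages of
   [- m] and 1/100. *)
clearbody m; have lambda_ge : - m <= lambda.
  rewrite -(ler_pM2r s0) lambdaE.
  have m1 : 0 < 1 + m by lra.
  by move: hlower; rewrite /= mulrAC ler_pdivrMr //; lra.
have lambda_le : lambda <= 1 / 100.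
  by rewrite -(ler_pM2r s0) lambdaE; move: hupper; rewrite mulrAC ler_pdivlMr; lra.
(* For a + b = 1 the probability of staying is a + lambda b, nonnegative as soon as lambda >= - a /
   b. *)
have stay (a b : R) : 0 < b -> a + b = 1 -> m <= a / b -> 0 <= lambda * 1 + (1 - lambda) * a.
  move=> b0 ab1; rewrite ler_pdivlMr // => mb.
  by have := ler_wpM2r (ltW b0) lambda_ge; have -> : a = 1 - b; [rewrite -ab1 addrK | lra].
have leave (a : R) : 0 < a -> 0 <= lambda * 0 + (1 - lambda) * a.
  by move=> a0; rewrite mulr0 add0r; apply: mulr_ge0; [lra | exact: ltW].
have trans0 a b : 0 <= trans p0 p1 lambda a b.
  rewrite /trans; case: a; case: b => /=.
  - by apply: stay p0_gt0 _ m_p1; rewrite addrC.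
  - exact: leave.
  - exact: leave.
  - exact: stay p1_gt0 p01 m_p0.
have adml : admissible p0 p1 lambda.
  apply/andP; split; first by rewrite ler_norml; apply/andP; split; lra.
  by apply/forallP => a; apply/forallP => b; exact: trans0.
split.
- apply/andP; split; last by lra.
  by apply: le_trans lambda_ge; rewrite lerN2.
- split=> [v' v|v].
    rewrite /G (sticky_walkE hdisj hcover hV0 hV1 hp0 hp1).
    set c := #|_|%:R; have c1 : 1 <= c.
      by have := block_gt0 hV0 hV1 (R := R) (v' \in V1); rewrite ltr0n -(ler_nat R).
    have t0 := trans0 (v \in V1) (v' \in V1).
    have t1 : trans p0 p1 lambda (v \in V1) (v' \in V1) <= 1.
      rewrite -[leRHS](trans_sum p01 lambda (v \in V1)) (bigD1 (v' \in V1)) //= lerDl.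
      by apply: sumr_ge0.
    have c0 : 0 < c by apply: lt_le_trans c1.
    apply/andP; split; first by rewrite divr_ge0 // ltW.
    by rewrite ler_pdivrMr // mul1r (le_trans t1).
  rewrite -(trans_sum p01 lambda (v \in V1)).
  have sumE := sum_block (M := R^o) hdisj hcover hV0 hV1
    (trans p0 p1 lambda (v \in V1)) (fun=> 1).
  transitivity (\sum_b trans p0 p1 lambda (v \in V1) b *: (1 : R^o)); last first.
    by apply: eq_bigr => b _; exact: mulr1.
  rewrite -sumE; apply: eq_bigr => v' _.
  by rewrite /G (sticky_walkE hdisj hcover hV0 hV1 hp0 hp1); apply/esym/mulr1.
(* A walk with [t] vertices makes [t - 1] steps. At [t = 0] this yields a Bernoulli law, harmless
   because only positive indices count. *)
have law t : exists P : probability int R, is_law P (sum_gf p0 p1 (nseq t.-1 lambda)).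
  apply: exists_law; last exact: sum_gf1.
  by apply: nnegp_sum_gf => //; rewrite all_nseq adml orbT.
have [N lawN] := choice law.
exists N; split=> [[|t] A // _|].
  by rewrite lawN (sum_val_rw_law hdisj hcover hV0 hV1 hval0 hval1 hp0 hp1).
apply: (@sticky_discrete_normal_family _ _ _ _ lambda) => //.
by have := lambdaE; lra.
Qed.
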